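(* Let $A$ be a well-ordered alphabet of order type $\omega$ and let $\mathrm{BF}(\omega)$ be the big free group on $A$, with associated $\mathbb Z^\omega$-tree $T(\mathrm{BF}(\omega))$. For every $\langle n,w\rangle\in T(\mathrm{BF}(\omega))$ there are $v\in\mathrm{BF}(\omega)$ and $a\in A$ such that $\langle n,w\rangle\in[v,va]$ or $\langle n,w\rangle\in[v,va^{-1}]$, where $[x,y]$ denotes the unique segment in $T(\mathrm{BF}(\omega))$ with endpoints $x$ and $y$.
   Context: **Big free groups.** Let $A^{-1}$ be a set of formal inverses of $A$, disjoint from $A$, with $(a^{-1})^{-1}=a$. A transfinite word is a function $w:S\to A\cup A^{-1}$ with $S$ totally ordered and $w^{-1}(\{x\})$ finite for every $x\in A\cup A^{-1}$. Words $w_1:S_1\to A\cup A^{-1}$, $w_2:S_2\to A\cup A^{-1}$ are identified if there is an order-preserving bijection $\phi:S_1\to S_2$ with $w_2\circ\phi=w_1$. A cancellation of $w$ is a subset $T\subset S$ with an involution $*:T\to T$ such that for each $t\in T$: the interval of $S$ with endpoints $t$ and $t^*$ is contained in $T$; this interval is mapped onto itself by $*$; and $w(t^* )=w(t)^{-1}$. Then the restriction of $w$ to $S\setminus T$ is said to arise from $w$ by the cancellation; the equivalence relation on words generated by this relation is used. A word is reduced if it admits no nonempty cancellation; each equivalence class contains exactly one reduced word (up to identification). $\mathrm{BF}(\omega)$ is the group of equivalence classes (equivalently, of reduced words) under concatenation, with inverse $w^{-1}$ obtained by reversing the order of $S$ and inverting each letter. Its identity is the empty word $\iota$. **Order and length.**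 $\mathbb Z^\omega=\prod_{a\in A}\mathbb Z$ has the lexicographic order: $(s_a)<(t_a)$ iff there is $a\in A$ with $s_a<t_a$ and $s_b=t_b$ for all $b<a$. For $w\in\mathrm{BF}(\omega)$, $L(w)=(n_a)_{a\in A}\in\mathbb Z^\omega$, where $n_a$ is the number of occurrences of $a$ and $a^{-1}$ in the reduced form of $w$; $c(g,h)=\frac12(L(g)+L(h)-L(g^{-1}h))$, which lies in $\mathbb Z^\omega$. **The tree.** With $\Lambda=\mathbb Z^\omega$ and $[a,b]_\Lambda=\{x\in\Lambda:a\le x\le b\}$, $T(\mathrm{BF}(\omega))$ is the disjoint union of the intervals $[0,L(g)]_\Lambda$, $g\in\mathrm{BF}(\omega)$, with $n\in[0,L(g)]_\Lambda$ and $n\in[0,L(h)]_\Lambda$ identified if $n\le c(g,h)$; the class of $n\in[0,L(g)]_\Lambda$ is denoted $\langle n,g\rangle$. The $\Lambda$-valued metric is $d(\langle n,g\rangle,\langle m,h\rangle)=n+m-2\min\{n,m,c(g,h)\}$. A segment is the image of a distance-preserving map from some $[a,b]_\Lambda$ (with metric $|x-y|$), its endpoints being the images of $a$ and $b$; $T(\mathrm{BF}(\omega))$ is a $\Lambda$-tree, in which any two points are the endpoints of a unique segment. An element $g\in\mathrm{BF}(\omega)$ is regarded as the point $\langle L(g),g\rangle$ of $T(\mathrm{BF}(\omega))$. *)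

(* Defs.v *)
From HB Require Import structures.
From Stdlib Require Import Relations.Relation_Operators.
From mathcomp Require Import all_boot all_order all_algebra generic_quotient.
From mathcomp Require Import finmap.
From mathcomp Require Import mathcomp_extra boolp classical_sets functions.
From mathcomp Require Import cardinality.

Set Implicit Arguments.
Unset Strict Implicit.
Unset Printing Implicit Defensive.

Import Order.TTheory GRing.Theory Num.Theory.
Local Open Scope classical_set_scope.
Local Open Scope ring_scope.
Local Open Scope quotient_scope.

Definition order_type_omega d (A : orderType d) : Prop :=
  exists f : A -> nat, bijective f /\ {mono f : x y / (x <= y)%O}.

(** * Transfinite words *)

(* The letter (a, false) is a and (a, true) is the formal inverse of a. *)
Definition letter (A : Type) : Type := (A * bool)%type.

Definition linv (A : Type) (x : letter A) : letter A := (x.1, ~~ x.2).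

(* The totally ordered domain is unbundled, because a record with a field in
   orderType is too large a type to be a choiceType. *)
Record word (A : Type) := Word {
  wdom : Type;
  wle : rel wdom;
  wle_anti : antisymmetric wle;
  wle_trans : transitive wle;
  wle_total : total wle;
  wfun : wdom -> letter A;
  wfinP : forall x : letter A, finite_set (wfun @^-1` [set x])
}.

HB.instance Definition _ (A : Type) := gen_eqMixin (word A).
HB.instance Definition _ (A : Type) := gen_choiceMixin (word A).

Coercion wfun : word >-> Funclass.

Section DomainOrder.
Variables (A : Type) (w : word A).

Fact wle_refl : reflexive (@wle A w).
Proof. by move=> s; have := wle_total s s; rewrite orbb. Qed.

HB.instance Definition _ := gen_eqMixin (wdom w).
HB.instance Definition _ := gen_choiceMixin (wdom w).
HB.instance Definition _ :=
  Order.Le_isPOrder.Build Order.default_display (wdom w)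
    wle_refl (@wle_anti A w) (@wle_trans A w).
HB.instance Definition _ :=
  Order.POrder_isTotal.Build Order.default_display (wdom w) (@wle_total A w).

End DomainOrder.

Definition word_iso (A : Type) (w1 w2 : word A) : Prop :=
  exists phi : wdom w1 -> wdom w2,
    [/\ bijective phi, {mono phi : s t / (s <= t)%O} & w2 \o phi =1 w1].

Section Restriction.
Variables (A : Type) (w : word A) (D : set (wdom w)).

Let dom : Type := {s : wdom w | D s}.
Let le : rel dom := fun s t => wle (sval s) (sval t).
Let f (s : dom) : letter A := w (sval s).

Fact restr_anti : antisymmetric le.
Proof.
by move=> s t /wle_anti /eq_sig_hprop; apply=> u; exact: Prop_irrelevance.
Qed.

Fact restr_trans : transitive le.
Proof. by move=> t s u; apply: wle_trans. Qed.

Fact restr_total : total le.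
Proof. by move=> s t; apply: wle_total. Qed.

Fact restr_finP (x : letter A) : finite_set (f @^-1` [set x]).
Proof.
have inj : {in (sval : dom -> wdom w) @^-1` (w @^-1` [set x]) &,
             injective (sval : dom -> wdom w)}.
  by move=> s t _ _ /eq_sig_hprop; apply=> u; exact: Prop_irrelevance.
exact: finite_preimage inj (@wfinP _ w x).
Qed.

Definition wrestrict : word A :=
  Word restr_anti restr_trans restr_total restr_finP.

End Restriction.

Section Concatenation.
Variables (A : Type) (w1 w2 : word A).

Let dom : Type := (wdom w1 + wdom w2)%type.

Let le : rel dom := fun x y =>
  match x, y with
  | inl s, inl t => wle s t
  | inl _, inr _ => true
  | inr _, inl _ => false
  | inr s, inr t => wle s t
  end.

Let f (s : dom) : letter A :=
  match s with inl t => w1 t | inr t => w2 t end.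

Fact cat_anti : antisymmetric le.
Proof. by case=> s [] t //= /wle_anti ->. Qed.

Fact cat_trans : transitive le.
Proof. by case=> t [] s [] u //=; apply: wle_trans. Qed.

Fact cat_total : total le.
Proof. by case=> s [] t //=; apply: wle_total. Qed.

Fact cat_finP (x : letter A) : finite_set (f @^-1` [set x]).
Proof.
apply: (@sub_finite_set _ _ ((inl @` (w1 @^-1` [set x])) `|`
                             (inr @` (w2 @^-1` [set x])))).
  by case=> t /= wt; [left | right]; exists t.
by rewrite finite_setU; split; apply: finite_image; apply: wfinP.
Qed.

Definition wcat : word A := Word cat_anti cat_trans cat_total cat_finP.

End Concatenation.

Section Inverse.
Variables (A : Type) (w : word A).

Let le : rel (wdom w) := fun s t => wle t s.
Let f (s : wdom w) : letter A := linv (w s).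

Fact inv_anti : antisymmetric le.
Proof. by move=> s t; rewrite andbC => /wle_anti. Qed.

Fact inv_trans : transitive le.
Proof. by move=> t s u st tu; apply: wle_trans tu st. Qed.

Fact inv_total : total le.
Proof. by move=> s t; apply: wle_total. Qed.

Fact inv_finP (x : letter A) : finite_set (f @^-1` [set x]).
Proof.
apply: sub_finite_set (@wfinP _ w (linv x)).
by move=> s /= <-; rewrite /f /linv /= negbK; case: (w s).
Qed.

Definition winv : word A := Word inv_anti inv_trans inv_total inv_finP.

End Inverse.

Section OneLetter.
Variables (A : Type) (x : letter A).

Let le : rel unit := fun _ _ => true.
Let f (_ : unit) : letter A := x.

Fact single_anti : antisymmetric le. Proof. by case=> -[]. Qed.

Fact single_trans : transitive le. Proof. by []. Qed.

Fact single_total : total le. Proof. by []. Qed.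

Fact single_finP (y : letter A) : finite_set (f @^-1` [set y]).
Proof. exact: finite_finset. Qed.

Definition wsingle : word A :=
  Word single_anti single_trans single_total single_finP.

End OneLetter.

(** * Cancellation *)

(* The closed interval with endpoints s and t, in whichever order they come. *)
Definition ord_interval d (S : orderType d) (s t : S) : set S :=
  [set u | (Order.min s t <= u)%O /\ (u <= Order.max s t)%O].

(* The involution of T is the restriction to T of star, whose values outside
   of T are irrelevant. *)
Definition cancellation (A : Type) (w : word A) (T : set (wdom w))
    (star : wdom w -> wdom w) : Prop :=
  forall t, T t ->
    [/\ T (star t),
        star (star t) = t,
        ord_interval t (star t) `<=` T,
        star @` ord_interval t (star t) = ord_interval t (star t)
      & w (star t) = linv (w t)].

Definition arises_by_cancellation (A : Type) (w u : word A) : Prop :=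
  exists (T : set (wdom w)) (star : wdom w -> wdom w),
    cancellation T star /\ word_iso (wrestrict (~` T)) u.

Definition reduced (A : Type) (w : word A) : Prop :=
  forall (T : set (wdom w)) (star : wdom w -> wdom w),
    cancellation T star -> T = set0.

(** * The big free group *)

Section GeneratedEquivalence.
Variables (X : choiceType) (R : X -> X -> Prop).

Definition gen_equiv : rel X := fun x y => `[< clos_refl_sym_trans X R x y >].

Fact gen_equiv_refl : reflexive gen_equiv.
Proof. by move=> x; apply/asboolP; apply: rst_refl. Qed.

Fact gen_equiv_sym : symmetric gen_equiv.
Proof. by move=> x y; apply/asboolP/asboolP; apply: rst_sym. Qed.

Fact gen_equiv_trans : transitive gen_equiv.
Proof.
by move=> y x z /asboolP xy /asboolP yz; apply/asboolP; apply: rst_trans xy yz.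
Qed.

Canonical gen_equiv_equiv :=
  EquivRel gen_equiv gen_equiv_refl gen_equiv_sym gen_equiv_trans.
Canonical gen_equiv_encModRel := defaultEncModRel gen_equiv.

End GeneratedEquivalence.

(* Isomorphic words are identified too, by means of the empty cancellation. *)
Definition BF (A : Type) :=
  {eq_quot (@gen_equiv (word A) (@arises_by_cancellation A))}.

HB.instance Definition _ (A : Type) := Choice.on (BF A).

Definition bf_class (A : Type) (w : word A) : BF A := \pi_(BF A) w.

(* Concatenation and inversion of words are compatible with the equivalence,
   so that the representatives chosen in bf_mul and bf_inv are irrelevant. *)
Definition bf_mul (A : Type) (g h : BF A) : BF A :=
  bf_class (wcat (repr g) (repr h)).

Definition bf_inv (A : Type) (g : BF A) : BF A := bf_class (winv (repr g)).

Definition bf_gen (A : Type) (a : A) : BF A := bf_class (wsingle (a, false)).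

(** * Lengths in the lexicographically ordered group Z^A *)

Section Length.
Context d (A : orderType d).

(* Not the order <= of functions in the library, which is pointwise. *)
Definition lexlt (s t : A -> int) : Prop :=
  exists a, s a < t a /\ forall b, (b < a)%O -> s b = t b.

Definition lexle (s t : A -> int) : Prop := s = t \/ lexlt s t.

Definition lexmin (s t : A -> int) : A -> int :=
  if `[< lexle s t >] then s else t.

Definition lexabs (s : A -> int) : A -> int :=
  if `[< lexle 0 s >] then s else - s.

Definition lex_interval (s t : A -> int) : set (A -> int) :=
  [set u | lexle s u /\ lexle u t].

(* Each class contains exactly one reduced word up to isomorphism, so that
   bf_len does not depend on the one which is chosen here. *)
Definition reduced_form (g : BF A) : word A :=
  xget (repr g) [set w | reduced w /\ bf_class w = g].

Definition bf_len (g : BF A) : A -> int :=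
  fun a => #|` fset_set [set s | (reduced_form g s).1 = a] |%:Z.

(* The division by 2 is exact. *)
Definition bf_c (g h : BF A) : A -> int :=
  fun a => ((bf_len g + bf_len h - bf_len (bf_mul (bf_inv g) h)) a %/ 2)%Z.

Lemma lexle0_bf_len (hA : order_type_omega A) (g : BF A) : lexle 0 (bf_len g).
Proof.
case: hA => f [[f' fK f'K] f_mono].
have [L0|/existsNP [a /eqP La]] := pselect (forall a, bf_len g a = 0).
  by left; apply/funext => a; rewrite L0.
have exP : exists n, bf_len g (f' n) != 0 by exists (f a); rewrite fK.
right; exists (f' (ex_minn exP)); case: ex_minnP => n Ln minn; split.
  by rewrite lt_def Ln.
move=> b ltb; apply/esym/eqP/negPn/negP => Lb.
have /minn : bf_len g (f' (f b)) != 0 by rewrite fK.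
by rewrite -[n]f'K; move: ltb; rewrite ltNge -f_mono => /negP.
Qed.

End Length.

(** * The tree *)

Section Tree.
Context d (A : orderType d).

Definition prepoint : Type :=
  {p : (A -> int) * BF A | p.1 \in lex_interval 0 (bf_len p.2)}.
HB.instance Definition _ := Choice.on prepoint.

Definition preheight (p : prepoint) : A -> int := (val p).1.
Definition preelt (p : prepoint) : BF A := (val p).2.

Definition identified (p q : prepoint) : Prop :=
  preheight p = preheight q /\
  lexle (preheight p) (bf_c (preelt p) (preelt q)).

(* This relation is already an equivalence, so that passing to the generated
   equivalence adds no identification. *)
Definition tree := {eq_quot (@gen_equiv prepoint identified)}.

HB.instance Definition _ := Choice.on tree.

Definition tree_point (n : A -> int) (g : BF A)
    (hn : n \in lex_interval 0 (bf_len g)) : tree :=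
  \pi_tree (exist _ (n, g) hn : prepoint).

Definition predist (p q : prepoint) : A -> int :=
  preheight p + preheight q
  - lexmin (preheight p)
      (lexmin (preheight q) (bf_c (preelt p) (preelt q))) *+ 2.

(* predist is invariant under identification. *)
Definition dist (x y : tree) : A -> int := predist (repr x) (repr y).

Definition is_segment (x y : tree) (Sg : set tree) : Prop :=
  exists (a b : A -> int) (f : (A -> int) -> tree),
    [/\ lexle a b,
        forall s t, lex_interval a b s -> lex_interval a b t ->
          dist (f s) (f t) = lexabs (s - t),
        f a = x, f b = y
      & Sg = f @` lex_interval a b].

Definition segment (x y : tree) : set tree := xget set0 (is_segment x y).

Fact vertex_subproof (hA : order_type_omega A) (g : BF A) :
  bf_len g \in lex_interval 0 (bf_len g).
Proof. by rewrite inE; split; [apply: lexle0_bf_len | left]. Qed.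

Definition vertex (hA : order_type_omega A) (g : BF A) : tree :=
  tree_point (vertex_subproof hA g).

End Tree.

(* Main.v *)
Require Import Defs.
From Stdlib Require Import Relations.Relation_Operators.
From mathcomp Require Import all_boot all_order all_algebra generic_quotient.
From mathcomp Require Import zify finmap.
From mathcomp Require Import boolp classical_sets functions cardinality filter.

Set Implicit Arguments.
Unset Strict Implicit.
Unset Printing Implicit Defensive.

Import Order.TTheory GRing.Theory Num.Theory.
Local Open Scope classical_set_scope.
Local Open Scope ring_scope.
Local Open Scope quotient_scope.

(* Deleting from a word all but the first k letters of the alphabet leaves a
   finite word, whose free reduction depends only on the class of the word.
   The letters of a reduced word are eventually not cancelled in these finite
   projections: otherwise an ultralimit of finite cancellations would be a
   cancellation of the word. Hence L and c are limits, along an ultrafilter, of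
   letter counts in free groups, where c counts the letters of the longest
   common prefix; this makes c ultrametric and the segments of the tree unique.
   Given <n, w> with w reduced, let D be the set of positions s such that the
   initial segment of w ending at s has length at most n, and let v be the
   restriction of w to D. Since letters occur finitely often, L(v) <= n. If the
   complement of D has a least element s, then <n, w> lies between v and v w(s).
   Otherwise the complement of D can be approached from above, so n = L(v), and
   <n, w> is the vertex v itself. *)

(** * Free reduction *)

Section FreeReduction.
Variable A : eqType.
Implicit Types (x y : letter A) (r s t : seq (letter A)).

Lemma linvK : involutive (@linv A).
Proof. by case=> a b; rewrite /linv /= negbK. Qed.

Lemma linv_neq x : linv x != x.
Proof. by case: x => a []; rewrite /linv xpair_eqE andbF. Qed.

(** Left multiplication by a letter in the free group, acting on reduced sequences. *)
Definition push x r :=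
  if r is y :: r' then if y == linv x then r' else x :: r else [:: x].

Definition freered s := foldr push [::] s.

Definition freely_reduced s := sorted (fun x y => y != linv x) s.

Definition seqinv s := rev (map (@linv A) s).

Lemma push_freely_reduced x r : freely_reduced r -> freely_reduced (push x r).
Proof.
case: r => [|y r] //= yr; case: ifPn => [_|/= -> //].
exact: path_sorted yr.
Qed.

(** If [push x] deletes the head [linv x], reducedness keeps the next letter from being [x], so
    pushing [linv x] restores the head instead of cancelling again. *)
Lemma push_linvK x r : freely_reduced r -> push (linv x) (push x r) = r.
Proof.
case: r => [|y r] /=; first by rewrite linvK eqxx.
case: eqP => [->|_] yr; last by rewrite /= linvK eqxx.
by case: r yr => [//|z r] /= /andP[/negPf ->].
Qed.

Lemma foldr_push_freely_reduced r s :
  freely_reduced r -> freely_reduced (foldr push r s).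
Proof. by move=> rr; elim: s => //= x s; apply: push_freely_reduced. Qed.

Lemma freered_freely_reduced s : freely_reduced (freered s).
Proof. exact: foldr_push_freely_reduced. Qed.

Lemma push_id x r : freely_reduced (x :: r) -> push x r = x :: r.
Proof. by case: r => //= y r /andP[/negPf ->]. Qed.

Lemma freered_id s : freely_reduced s -> freered s = s.
Proof.
elim: s => //= x s IHs xs; rewrite IHs; last exact: path_sorted xs.
exact: push_id.
Qed.

(* Reduced sequences carry the left regular action of the free group. *)
Lemma foldr_push_freered r s :
  freely_reduced r -> foldr push r (freered s) = foldr push r s.
Proof.
move=> rr; elim: s => //= x s IHs.
have := freered_freely_reduced s; rewrite -IHs.
case: (freered s) => [|y s'] //=; case: eqP => //= -> _.
rewrite -{1}[x]linvK push_linvK //; exact: foldr_push_freely_reduced.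
Qed.

Lemma freered_cat s t : freered (s ++ t) = foldr push (freered t) s.
Proof. exact: foldr_cat. Qed.

Lemma freered_catl s t : freered (freered s ++ t) = freered (s ++ t).
Proof.
by rewrite !freered_cat foldr_push_freered // freered_freely_reduced.
Qed.

Lemma freered_catr s t : freered (s ++ freered t) = freered (s ++ t).
Proof. by rewrite !freered_cat freered_id // freered_freely_reduced. Qed.

Lemma freered_idem s : freered (freered s) = freered s.
Proof. by rewrite freered_id // freered_freely_reduced. Qed.

Lemma seqinv_cons x s : seqinv (x :: s) = rcons (seqinv s) (linv x).
Proof. by rewrite /seqinv /= rev_cons. Qed.

Lemma seqinv_cat s t : seqinv (s ++ t) = seqinv t ++ seqinv s.
Proof. by rewrite /seqinv map_cat rev_cat. Qed.

Lemma foldr_push_seqinvK r s :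
  freely_reduced r -> foldr push (foldr push r s) (seqinv s) = r.
Proof.
move=> rr; elim: s => //= x s IHs.
rewrite seqinv_cons foldr_rcons push_linvK //.
exact: foldr_push_freely_reduced.
Qed.

Lemma freered_seqinvK s t : freered (seqinv s ++ s ++ t) = freered t.
Proof.
by rewrite freered_cat freered_cat foldr_push_seqinvK ?freered_freely_reduced.
Qed.

Lemma foldr_push_seqinv_freered r s : freely_reduced r ->
  foldr push r (seqinv (freered s)) = foldr push r (seqinv s).
Proof.
elim: s r => //= x s IHs r rr.
rewrite seqinv_cons foldr_rcons -IHs ?push_freely_reduced //.
case: (freered s) => [|y s'] //=; case: eqP => [->|_].
  rewrite seqinv_cons foldr_rcons linvK.
  by rewrite -{1}[x]linvK push_linvK.
by rewrite seqinv_cons foldr_rcons.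
Qed.

Lemma freered_seqinv_catl s t :
  freered (seqinv (freered s) ++ t) = freered (seqinv s ++ t).
Proof.
by rewrite !freered_cat foldr_push_seqinv_freered ?freered_freely_reduced.
Qed.

(** * Longest common prefixes, which measure cancellation in the free group *)

Fixpoint lcp s t :=
  if s is x :: s' then
    if t is y :: t' then if x == y then x :: lcp s' t' else [::] else [::]
  else [::].

Lemma lcpC s t : lcp s t = lcp t s.
Proof.
by elim: s t => [|x s IHs] [|y t] //=; rewrite eq_sym IHs; case: eqP => [->|].
Qed.

Lemma lcpxx s : lcp s s = s.
Proof. by elim: s => //= x s ->; rewrite eqxx. Qed.

Lemma lcps0 s : lcp s [::] = [::].
Proof. by case: s. Qed.

(** Look at the first place where the three sequences do not all agree: either [s] and [t] separate
    there, or they separate from [r] together. *)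
Lemma lcp_ultrametric s t r :
  prefix (lcp s t) (lcp s r) || prefix (lcp t r) (lcp s r).
Proof.
elim: s t r => [|x s IHs] t r; first by rewrite prefix0s.
case: t => [|y t]; first by rewrite prefix0s.
case: r => [|z r]; first by rewrite prefix0s orbT.
rewrite /=; case: (eqVneq x y) => [<-|_]; last by rewrite prefix0s.
by case: (eqVneq x z) => _; rewrite ?prefix0s ?orbT ?prefix_cons ?eqxx ?IHs.
Qed.

Lemma freered_seqinv_cat s t : freely_reduced s -> freely_reduced t ->
  (if s is x :: _ then if t is y :: _ then x != y else true else true) ->
  freered (seqinv s ++ t) = seqinv s ++ t.
Proof.
rewrite freered_cat => sr tr; rewrite [freered t]freered_id //.
elim: s t sr tr => //= x s IHs t sr tr xt.
(* The head of [s] crosses the junction as its inverse; the hypotheses persist with [linv x :: t] in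
   place of [t]. *)
have {}tr : freely_reduced (linv x :: t).
  move: tr xt; case: t => [|y t] //= tr xt.
  by rewrite /freely_reduced /= linvK eq_sym xt; exact: tr.
rewrite seqinv_cons foldr_rcons cat_rcons push_id //; apply: IHs => //.
  exact: path_sorted sr.
by case: s sr => //= z s /andP[].
Qed.

Lemma count_seqinv (P : pred A) s :
  count (P \o fst) (seqinv s) = count (P \o fst) s.
Proof. by rewrite count_rev count_map; apply: eq_count. Qed.

(** In the product of the inverse of [s] with [t], exactly the common prefix cancels, once from each
    factor. *)
Lemma count_freered_seqinv_cat (P : pred A) s t :
  freely_reduced s -> freely_reduced t ->
  (count (P \o fst) (freered (seqinv s ++ t))
   + (count (P \o fst) (lcp s t)).*2 =
   count (P \o fst) s + count (P \o fst) t)%N.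
Proof.
elim: s t => [|x s IHs] t sr tr; first by rewrite addn0 freered_id.
case: t tr => [|y t] tr.
  by rewrite freered_seqinv_cat //= cats0 count_seqinv.
rewrite [lcp _ _]/=; case: eqP => [exy|/eqP nxy]; last first.
  by rewrite freered_seqinv_cat // count_cat count_seqinv addn0.
have := IHs t (path_sorted sr) (path_sorted tr).
rewrite -exy seqinv_cons cat_rcons !freered_cat /=.
rewrite push_linvK ?freered_freely_reduced //.
lia.
Qed.

(** The last letter of [s] cannot be inverse to both [x] and [linv x]. This later provides a sign
    for which appending a generator cancels nothing. *)
Lemma freely_reduced_rcons s x : freely_reduced s ->
  freely_reduced (rcons s x) \/ freely_reduced (rcons s (linv x)).
Proof.
case/lastP: s => [|s y] sr; first by left.
rewrite /freely_reduced -!cats1 -!catA /=.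
have sc z : freely_reduced (rcons (rcons s y) z) = (z != linv y).
  move: sr; rewrite /freely_reduced; case: s => /= [_|u s].
    by rewrite andbT.
  by rewrite !rcons_path last_rcons => ->.
have := sc x; have := sc (linv x); rewrite /freely_reduced -!cats1 -!catA /=.
move=> -> ->; case: eqP => [->|_]; last by left.
by right; rewrite linvK eq_sym linv_neq.
Qed.

End FreeReduction.

(** * Cancellation in finite sequences *)

Section ListCancellation.
Context (A : eqType) (d : Order.disp_t) (S : orderType d) (w : S -> letter A).
Implicit Types (l : seq S) (T : set S) (star : S -> S) (s t u x y : S).

Lemma ord_intervalC s t : ord_interval s t = ord_interval t s.
Proof. by rewrite /ord_interval minC maxC. Qed.

Lemma ord_intervalE s t u : (s <= t)%O ->
  ord_interval s t u <-> (s <= u)%O /\ (u <= t)%O.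
Proof. by move=> st; rewrite /ord_interval /= min_l // max_r. Qed.

(** The conditions of a cancellation, tested only at positions of [l]. Intervals are only required
    to be mapped into themselves, which for an involution is the same as onto. *)
Definition seq_cancellation l T star := forall t, t \in l -> T t ->
  [/\ T (star t), star t \in l, star (star t) = t, w (star t) = linv (w t)
    & forall u, u \in l -> ord_interval t (star t) u ->
        T u /\ ord_interval t (star t) (star u)].

Lemma sub_seq_cancellation l l' T star : seq_cancellation l T star ->
  {subset l' <= l} -> (forall t, t \in l' -> T t -> star t \in l') ->
  seq_cancellation l' T star.
Proof.
move=> lT l'l l'star t tl' Tt; have [? ? ? ? itv] := lT _ (l'l _ tl') Tt.
by split=> // [|u /l'l]; [exact: l'star | exact: itv].
Qed.

(** Strong induction on the length. If the head [x] is matched with [y], the list is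
    [x :: l1 ++ y :: l2]; all of [l1] is matched within itself and reduces to nothing, then [x]
    cancels [y], and [l2] remains. *)
Lemma freered_seq_cancellation l T star : sorted <%O l ->
  seq_cancellation l T star ->
  freered (map w l) = freered (map w [seq s <- l | ~~ `[< T s >]]).
Proof.
have [m] := ubnP (size l); elim: m l => // m IHm [//|x l] /= lm xl lT.
have [Tx|nTx] := pselect (T x); last first.
  rewrite asboolF //= (IHm l) //; first exact: path_sorted xl.
  apply: (sub_seq_cancellation lT) => [t tl|t tl Tt].
    by rewrite inE tl orbT.
  have [Tst] := lT t (mem_behead (s := x :: l) tl) Tt.
  by rewrite inE => /orP[/eqP stx|//]; rewrite stx in Tst.
rewrite asboolT //=; have [Ty yl stK wst itv] := lT x (mem_head _ _) Tx.
have xy : star x != x.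
  by apply/eqP => E; have := linv_neq (w x); rewrite -wst E eqxx.
move: yl; rewrite inE (negPf xy) /= => yl.
have ltx u : u \in l -> (x < u)%O.
  by move=> ul; move: xl; rewrite lt_path_sortedE => /andP[/allP/(_ _ ul)].
have xsx := ltx _ yl; set y := star x in xy Ty stK wst itv yl xsx *.
case/splitPr: l / yl lm xl lT itv ltx => l1 l2 lm xl lT itv ltx.
have xyl : sorted <%O (x :: l1 ++ y :: l2) by [].
have /= lt1 u : u \in l1 -> (x < u < y)%O.
  move=> ul; rewrite ltx ?mem_cat ?ul //=.
  move: (path_sorted xl); rewrite lt_sorted_pairwise pairwise_cat.
  by case/andP => /allrelP/(_ u y ul (mem_head _ _)).
have lt2 u : u \in l2 -> (y < u)%O.
  move=> ul; move: (path_sorted xl); rewrite lt_sorted_pairwise pairwise_cat /=.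
  by case/and4P => _ _ /allP/(_ u ul).
(* The interval from [x] to [y] is invariant, and its endpoints are already each other's
   partners. *)
have star1 t : t \in l1 -> T t /\ star t \in l1.
  move=> tl; have /andP[xt ty] := lt1 _ tl.
  have tl' : t \in x :: l1 ++ y :: l2 by rewrite inE mem_cat tl orbT.
  have [] := itv t tl'.
    by apply/(ord_intervalE _ (ltW xsx)); split; apply: ltW.
  move=> Tt /(ord_intervalE _ (ltW xsx))[xst sty]; split=> //.
  have [_ + stKt _ _] := lT _ tl' Tt; rewrite inE mem_cat inE.
  case/or4P => [/eqP stx|//|/eqP sty'|/lt2].
  - by move: ty; rewrite -stKt stx ltxx.
  - by move: xt; rewrite -stKt sty' stK ltxx.
  - by rewrite ltNge sty.
(* The positions up to [y] are matched among themselves, so none of them can be the partner of a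
   position in [l2]. *)
have star2 t : t \in l2 -> T t -> star t \in l2.
  move=> tl Tt; have yt := lt2 _ tl.
  have tl' : t \in x :: l1 ++ y :: l2 by rewrite inE mem_cat inE tl !orbT.
  have [_ + stKt _ _] := lT _ tl' Tt; rewrite inE mem_cat inE.
  case/or4P => [/eqP stx|/star1[_]|/eqP sty|//].
  - by move: yt; rewrite -stKt stx ltxx.
  - by rewrite stKt => /lt1/andP[_ /lt_trans/(_ yt)]; rewrite ltxx.
  - by move: yt; rewrite -stKt sty stK => /(lt_trans xsx); rewrite ltxx.
have sl1 : {subset l1 <= x :: l1 ++ y :: l2}.
  by move=> u ul; rewrite inE mem_cat ul orbT.
have sl2 : {subset l2 <= x :: l1 ++ y :: l2}.
  by move=> u ul; rewrite inE mem_cat inE ul !orbT.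
move: xyl; rewrite /= path_sortedE ?lt_sorted_pairwise; last exact: lt_trans.
rewrite pairwise_cat /= -!lt_sorted_pairwise => /and5P[_ _ sl1' _ sl2'].
rewrite !size_cat /= in lm.
have f1 : [seq s <- l1 | ~~ `[< T s >]] = [::].
  rewrite (@eq_in_filter _ _ pred0) ?filter_pred0 // => u /star1[Tu _].
  by rewrite asboolT.
have r1 : freered (map w l1) = [::].
  rewrite (IHm l1) ?f1 //; first lia.
  by apply: (sub_seq_cancellation lT) => // t /star1[].
have r2 : freered (map w l2) = freered (map w [seq s <- l2 | ~~ `[< T s >]]).
  by rewrite (IHm l2) //; [lia|apply: (sub_seq_cancellation lT)].
rewrite filter_cat /= asboolT //= f1 -r2 /= map_cat /= freered_cat /=.
have red2 := freered_freely_reduced (map w l2).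
rewrite -foldr_push_freered ?push_freely_reduced // r1 /= wst.
by rewrite -{1}[w x]linvK push_linvK.
Qed.

(* Matching the new head with the first unmatched position, whenever they
   cancel, realizes the free reduction as a cancellation. *)
Lemma seq_cancellation_exists l : sorted <%O l ->
  exists T star, [/\ seq_cancellation l T star, T `<=` [set` l]
    & map w [seq s <- l | ~~ `[< T s >]] = freered (map w l)].
Proof.
elim: l => [|x l IHl] xl; first by exists set0, id; split.
have [T [star [lT Tl red]]] := IHl (path_sorted xl).
have ltx u : u \in l -> (x < u)%O.
  by move=> ul; move: xl; rewrite /= lt_path_sortedE => /andP[/allP/(_ _ ul)].
have nTx : ~ T x by move=> /Tl /= /ltx; rewrite ltxx.
have lTx : seq_cancellation (x :: l) T star.
  move=> t _ Tt; have [Tst stl stK wst itv] := lT t (Tl _ Tt) Tt.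
  split=> // [|u]; first by rewrite inE stl orbT.
  rewrite inE => /orP[/eqP ->|/itv //].
  by case; rewrite ge_min !leNgt !ltx //; apply: Tl.
case EF: [seq s <- l | ~~ `[< T s >]] red => [|y F] red.
  exists T, star; split=> // [u /Tl|]; first by rewrite /= inE orbC => ->.
  by rewrite /= asboolF //= EF -red.
have [wyx|wyx] := eqVneq (w y) (linv (w x)); last first.
  exists T, star; split=> // [u /Tl|]; first by rewrite /= inE orbC => ->.
  by rewrite /= asboolF //= EF -red /= (negPf wyx).
have [yl nTy] : y \in l /\ ~ T y.
  have : y \in y :: F by rewrite mem_head.
  by rewrite -EF mem_filter => /andP[/asboolPn].
have Fy u : u \in F -> (y < u)%O.
  move=> uF; have : sorted <%O (y :: F).
    by rewrite -EF; apply: lt_sorted_filter (path_sorted xl).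
  by rewrite /= lt_path_sortedE => /andP[/allP/(_ _ uF)].
(* [y] is the first unmatched position of [l]. *)
have Ty u : u \in l -> (u < y)%O -> T u.
  move=> ul uy; apply: contrapT => nTu.
  have : u \in y :: F by rewrite -EF mem_filter ul andbT; apply/asboolPn.
  rewrite inE => /orP[/eqP E|/Fy /(lt_trans uy)]; last by rewrite ltxx.
  by rewrite E ltxx in uy.
have xy := ltx _ yl.
pose star' u := if u == x then y else if u == y then x else star u.
have star'x : star' x = y by rewrite /star' eqxx.
have star'y : star' y = x by rewrite /star' eqxx gt_eqF.
have star'T u : T u -> star' u = star u.
  by rewrite /star' => Tu; case: eqP Tu => [->|_] //; case: eqP => [->|].
have itvxy u : u \in x :: l -> ord_interval x y u ->
    [\/ u = x, u = y | T u] /\ ord_interval x y (star' u).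
  rewrite inE => ul /(ord_intervalE _ (ltW xy))[xu uy].
  have xyE := ord_intervalE _ (ltW xy).
  have [->|ux] := eqVneq u x.
    by split; [constructor|rewrite star'x; apply/xyE; rewrite lexx ltW].
  rewrite (negPf ux) /= in ul.
  have [->|uy'] := eqVneq u y.
    by split; [constructor|rewrite star'y; apply/xyE; rewrite lexx ltW].
  have {uy'}uy : (u < y)%O by rewrite lt_neqAle uy' uy.
  have Tu := Ty u ul uy; split; first by constructor.
  have [Tsu sul _ _ itv] := lT u ul Tu.
  rewrite star'T //; apply/xyE; split; first exact/ltW/ltx.
  (* A partner of [u] beyond [y] would put [y] in an interval contained in [T]. *)
  rewrite leNgt; apply/negP => ysu; apply: nTy.
  have [] // := itv y yl.
  by apply/ord_intervalE; rewrite ?ltW // (lt_trans uy).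
exists [set u | [\/ u = x, u = y | T u]], star'; split.
- move=> t tl [->|->|Tt].
  + rewrite star'x star'y; split=> //; first by constructor.
    by rewrite inE yl orbT.
  + rewrite star'y star'x ord_intervalC; split=> //; first by constructor.
      by rewrite mem_head.
    by rewrite wyx linvK.
  + have [Tst stl stK wst itv] := lTx t tl Tt; rewrite star'T //.
    split=> // [||u ul /(itv u ul)[Tu]]; first by constructor.
      by rewrite star'T.
    by rewrite star'T //; split=> //; constructor.
- by move=> u /= [->|->|/Tl ul]; rewrite inE ?eqxx ?yl ?ul ?orbT.
- rewrite /= asboolT /=; last by constructor.
  rewrite -red /= wyx eqxx; congr (map w _).
  have -> : F = [seq u <- y :: F | u != y].
    rewrite /= eqxx; apply/esym/all_filterP/allP => u /Fy.
    by rewrite lt_neqAle eq_sym => /andP[].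
  rewrite -EF -filter_predI; apply: eq_in_filter => u ul /=.
  apply/asboolPn/andP => [nT|[/eqP uy /asboolPn nTu] [E|//|//]].
    by split; [apply/eqP|apply/asboolPn] => ?; apply: nT; constructor.
  by have := ltx u ul; rewrite E ltxx.
Qed.

End ListCancellation.

(** * Finite projections and their ultralimits *)

Section FiniteProjections.
Context (A : eqType) (f : A -> nat) (f' : nat -> A) (fK : cancel f f').
Implicit Types (w u v : word A) (k : nat) (g h : BF A).

Lemma finite_index_lt k w : finite_set [set s | (f (w s).1 < k)%N].
Proof using f' fK.
elim: k => [|k IHk].
  by rewrite (_ : [set _ | _] = set0) //; apply/seteqP; split.
pose fib b := w @^-1` [set (f' k, b)].
apply: (@sub_finite_set _ _ ([set s | (f (w s).1 < k)%N]
                            `|` (fib false `|` fib true))); last first.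
  by rewrite !finite_setU; split=> //; split; apply: wfinP.
move=> s /=; rewrite ltnS leq_eqVlt => /orP[/eqP fk|]; last by left.
by right; rewrite /fib /= -fk fK; case: (w s) => a []; [right|left].
Qed.

Definition wpos k w : seq (wdom w) :=
  sort <=%O (fset_set [set s | (f (w s).1 < k)%N]).

Lemma mem_wpos k w s : (s \in wpos k w) = (f (w s).1 < k)%N.
Proof using f' fK.
rewrite mem_sort in_fset_set; last exact: finite_index_lt.
by apply/idP/idP; rewrite inE.
Qed.

Lemma wpos_sorted k w : sorted <%O (wpos k w).
Proof.
rewrite lt_sorted_uniq_le sort_uniq fset_uniq /=.
exact: (sort_sorted (@le_total _ _)).
Qed.

Lemma wpos_eq k w (l : seq (wdom w)) : sorted <%O l ->
  (forall s, (s \in l) = (f (w s).1 < k)%N) -> l = wpos k w.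
Proof using f' fK.
move=> sl ml; apply: lt_sorted_eq => // [|s]; first exact: wpos_sorted.
by rewrite ml mem_wpos.
Qed.

Lemma wpos_filter j k w : (j <= k)%N ->
  [seq s <- wpos k w | (f (w s).1 < j)%N] = wpos j w.
Proof using f' fK.
move=> jk; apply: wpos_eq => [|s]; first exact/lt_sorted_filter/wpos_sorted.
by rewrite mem_filter mem_wpos; case: ltnP => //= /leq_trans; apply.
Qed.

Definition wproj k w := map w (wpos k w).

(** Common source of the rules for isomorphic words, restrictions and single letters. *)
Lemma wproj_embedding k u w (phi : wdom u -> wdom w) :
    {mono phi : s t / (s <= t)%O} -> w \o phi =1 u ->
  wproj k u = map w [seq s <- wpos k w | `[< exists t, phi t = s >]].
Proof using f' fK.
move=> phi_le wphi; rewrite /wproj -(eq_map wphi) map_comp; congr map.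
have phi_lt : {mono phi : s t / (s < t)%O} by apply: leW_mono.
apply: lt_sorted_eq => [||s].
- by rewrite sorted_map (@eq_sorted _ _ <%O) ?wpos_sorted.
- exact/lt_sorted_filter/wpos_sorted.
rewrite mem_filter mem_wpos; apply/mapP/andP => [[t tu ->]|[]].
  by split; [apply/asboolP; exists t|move: tu; rewrite mem_wpos -wphi].
by move=> /asboolP[t <-] ft; exists t => //; rewrite mem_wpos -wphi.
Qed.

Lemma wproj_iso k u w : word_iso u w -> wproj k u = wproj k w.
Proof using f' fK.
case=> phi [[psi _ psiK] phi_le wphi]; rewrite (wproj_embedding k phi_le wphi).
congr map; apply/all_filterP/allP => s _; apply/asboolP.
by exists (psi s).
Qed.

Lemma wproj_wrestrict k w (D : set (wdom w)) :
  wproj k (wrestrict D) = map w [seq s <- wpos k w | `[< D s >]].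
Proof using f' fK.
rewrite (@wproj_embedding k (wrestrict D) w (fun s => sval s)) //.
congr map; apply: eq_filter => s; apply/asboolP/asboolP => [[[t Dt] <-] //|Ds].
by exists (exist _ s Ds).
Qed.

Lemma wproj_wcat k u w : wproj k (wcat u w) = wproj k u ++ wproj k w.
Proof using f' fK.
rewrite /wproj; pose inL : wdom u -> wdom (wcat u w) := inl.
pose inR : wdom w -> wdom (wcat u w) := inr.
have <- : map inL (wpos k u) ++ map inR (wpos k w) = wpos k (wcat u w).
  apply: wpos_eq => [|s].
    have ltL : {mono inL : s t / (s < t)%O} by apply: leW_mono.
    have ltR : {mono inR : s t / (s < t)%O} by apply: leW_mono.
    rewrite lt_sorted_pairwise pairwise_cat -!lt_sorted_pairwise !sorted_map.
    rewrite !(@eq_sorted _ _ <%O) ?wpos_sorted // !andbT.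
    by apply/allrelP => _ _ /mapP[s _ ->] /mapP[t _ ->].
  rewrite mem_cat; case: s => s.
    rewrite -/(inL s) mem_map ?mem_wpos; last by move=> ? ? [].
    by rewrite orbC; case: mapP => [[? _ //]|].
  rewrite -/(inR s) orbC mem_map ?mem_wpos; last by move=> ? ? [].
  by rewrite orbC; case: mapP => [[? _ //]|].
by rewrite map_cat -!map_comp.
Qed.

Lemma wproj_winv k w : wproj k (winv w) = seqinv (wproj k w).
Proof using f' fK.
rewrite /wproj.
have <- : (rev (wpos k w) : seq (wdom (winv w))) = wpos k (winv w).
  apply: wpos_eq => [|s]; last by rewrite mem_rev; exact: (@mem_wpos k w s).
  rewrite rev_sorted (@eq_sorted _ _ (<%O : rel (wdom w))) ?wpos_sorted //.
by rewrite map_rev /seqinv -map_comp.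
Qed.

Lemma wproj_wsingle k x : (f x.1 < k)%N -> wproj k (wsingle x) = [:: x].
Proof using f' fK.
move=> xk; rewrite /wproj -(@wpos_eq k (wsingle x) [:: tt]) //.
by case; rewrite inE eqxx.
Qed.

(** The partner of a position carries the inverse letter, hence one of the same index, so a
    cancellation of [w] restricts to the positions of each projection. *)
Lemma freered_wproj_arises k w u : arises_by_cancellation w u ->
  freered (wproj k w) = freered (wproj k u).
Proof using f' fK.
case=> T [star [wT /wproj_iso <-]]; rewrite wproj_wrestrict /wproj.
rewrite (@freered_seq_cancellation _ _ _ w _ T star) ?wpos_sorted //.
  by under eq_filter do rewrite -asbool_neg.
move=> t tk Tt; have [? ? itv imitv wst] := wT t Tt.
split=> // [|s sk st]; first by rewrite mem_wpos wst -mem_wpos.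
by split; [exact: itv|rewrite -imitv; exists s].
Qed.

(** The image of [g] in the free group on the first [k] letters; [bproj_class] frees it from the
    chosen representative. *)
Definition bproj k g := freered (wproj k (repr g)).

Lemma bproj_class k w : bproj k (bf_class w) = freered (wproj k w).
Proof using f' fK.
have : gen_equiv (@arises_by_cancellation A) (repr (bf_class w)) w.
  apply/(eqmodP (gen_equiv_equiv (@arises_by_cancellation A))).
  by rewrite reprK.
rewrite /bproj; move: (repr _) => u /asboolP.
by elim=> // [x y /freered_wproj_arises -> //|x y z _ -> _ ->].
Qed.

Lemma bproj_freely_reduced k g : freely_reduced (bproj k g).
Proof. exact: freered_freely_reduced. Qed.

Lemma bproj_mul k g h : bproj k (bf_mul g h) = freered (bproj k g ++ bproj k h).
Proof using f' fK.
by rewrite bproj_class wproj_wcat freered_catl freered_catr.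
Qed.

Lemma bproj_inv k g : bproj k (bf_inv g) = freered (seqinv (bproj k g)).
Proof using f' fK.
rewrite bproj_class wproj_winv -[in RHS](cats0 (seqinv _)).
by rewrite freered_seqinv_catl cats0.
Qed.

Lemma bproj_inv_mul k g h :
  bproj k (bf_mul (bf_inv g) h) = freered (seqinv (bproj k g) ++ bproj k h).
Proof using f' fK. by rewrite bproj_mul bproj_inv freered_catl. Qed.

End FiniteProjections.

(** * Passing to the limit along a nonprincipal ultrafilter *)

Section UltraLimit.
Context (U : set_system nat) (U_ultra : UltraFilter U) (Uoo : \oo `<=` U).

Let U_proper : ProperFilter U := ultra_proper.
Local Existing Instance U_proper.

Lemma ultra_ge n : U [set k | (n <= k)%N].
Proof using Uoo. by apply: Uoo; exists n. Qed.

Lemma ultra_or (P Q : set nat) : U (P `|` Q) -> U P \/ U Q.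
Proof using U_ultra.
move=> PQ; have [|nP] := in_ultra_setVsetC P U_ultra; [by left | right].
by apply: filterS (filterI PQ nP) => k [[]].
Qed.

(** Pigeonhole for an ultrafilter: a finite union in [U] has a member in [U]. *)
Lemma ultra_exists_in (S : eqType) (l : seq S) (P : S -> nat -> Prop) :
  U [set k | exists2 s, s \in l & P s k] -> exists2 s, s \in l & U (P s).
Proof using U_ultra.
elim: l => [|x l IHl] UP; first by have [k []] := filter_ex UP.
have [Ux|/IHl[s sl Us]] : U (P x) \/ U [set k | exists2 s, s \in l & P s k].
- apply: ultra_or; apply: filterS UP => k [s].
  by rewrite inE => /orP[/eqP ->|sl] Ps; [left|right; exists s].
- by exists x; rewrite ?mem_head.
- by exists s; rewrite // inE sl orbT.
Qed.

Lemma ultra_const (S : Type) (F : nat -> S) (x y : S) :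
  U [set k | F k = x] -> U [set k | F k = y] -> x = y.
Proof using U_ultra.
by move=> Ux Uy; have [k [<- <-]] := filter_ex (filterI Ux Uy).
Qed.

Context (A : eqType) (f : A -> nat) (f' : nat -> A) (fK : cancel f f').

Definition lcount (a : A) (s : seq (letter A)) := count (pred1 a \o fst) s.

(* If the letter a were cancelled in the projections for U-many k, then the
   ultralimit of the corresponding cancellations would be a nonempty
   cancellation of the whole word. *)
Lemma reduced_lcount_wproj (w : word A) a : reduced w ->
  U [set k | lcount a (freered (wproj f k w)) = lcount a (wproj f k w)].
Proof using U_ultra Uoo fK.
move=> wred; have [//|Una] := in_ultra_setVsetC
  [set k | lcount a (freered (wproj f k w)) = lcount a (wproj f k w)] U_ultra.
have /choice[Ts TsP] k : exists Ts : set (wdom w) * (wdom w -> wdom w),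
    seq_cancellation w (wpos f k w) Ts.1 Ts.2
    /\ map w [seq s <- wpos f k w | ~~ `[< Ts.1 s >]] = freered (wproj f k w).
  have [T [star [? _ ?]]] := seq_cancellation_exists w (wpos_sorted f k w).
  by exists (T, star).
pose T : set (wdom w) := [set t | U [set k | (Ts k).1 t]].
(* Whenever the two counts differ, some occurrence of [a] is cancelled, and all occurrences of [a]
   lie in one finite list. *)
have [s _ Ts0] : exists2 s, s \in wpos f (f a).+1 w & T s.
  apply: ultra_exists_in; apply: filterS Una => k nk; apply: contrapT => nT.
  apply: nk; rewrite /= -(TsP k).2 /lcount /wproj !count_map count_filter.
  apply: eq_in_count => s sk /=; rewrite andbC.
  case: eqP => [sa|]; last by rewrite andbF.
  rewrite andbT; apply/asboolPn => Tsk; apply: nT; exists s => //.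
  by rewrite (mem_wpos fK) sa.
have idx t : U [set k | t \in wpos f k w].
  by apply: filterS (ultra_ge (f (w t).1).+1) => k; rewrite /= (mem_wpos fK).
(* For every [k] the partner of [t] carries the inverse letter, which leaves finitely many
   candidates; one of them is the partner for [U]-many [k]. *)
have /choice[star starP] t : exists y, T t -> U [set k | (Ts k).2 t = y].
  have [Tt|] := pselect (T t); last by exists t.
  have [y _ ?] : exists2 y, y \in wpos f (f (w t).1).+1 w
                          & U [set k | (Ts k).2 t = y].
    apply: ultra_exists_in; apply: filterS (filterI Tt (idx t)) => k [Tkt tk].
    exists ((Ts k).2 t) => //; have [_ _ _ wst _] := (TsP k).1 _ tk Tkt.
    by rewrite (mem_wpos fK) wst.
  by exists y.
suff wT : cancellation T star by rewrite (wred T star wT) in Ts0.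
(* Each condition on a cancellation concerns finitely many positions, so it can be read off from a
   single [k] at which all of them have their limit behaviour. *)
have ev t : T t ->
    U [set k | [/\ t \in wpos f k w, (Ts k).1 t & (Ts k).2 t = star t]].
  move=> Tt.
  by apply: filterS (filterI (idx t) (filterI Tt (starP t Tt))) => k [? []].
have Tstar t : T t -> T (star t).
  move=> Tt; apply: filterS (ev t Tt) => k [tk Tkt <-].
  by have [] := (TsP k).1 t tk Tkt.
have starK t : T t -> star (star t) = t.
  move=> Tt; have [k [[tk Tkt kst] [_ _ <-]]] :=
    filter_ex (filterI (ev t Tt) (ev _ (Tstar t Tt))).
  by rewrite -kst; have [] := (TsP k).1 t tk Tkt.
have itvT t u : T t -> ord_interval t (star t) u -> T u.
  move=> Tt ut.
  apply: filterS (filterI (ev t Tt) (idx u)) => k [[tk Tkt kst] uk].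
  by have [_ _ _ _ /(_ u uk)] := (TsP k).1 t tk Tkt; rewrite kst => /(_ ut)[].
have itv t u : T t -> ord_interval t (star t) u ->
    ord_interval t (star t) (star u).
  move=> Tt ut; have [k [[tk Tkt kst] [uk _ <-]]] :=
    filter_ex (filterI (ev t Tt) (ev u (itvT t u Tt ut))).
  by have [_ _ _ _ /(_ u uk)] := (TsP k).1 t tk Tkt; rewrite kst => /(_ ut)[].
move=> t Tt; split; [exact: Tstar|exact: starK|by move=> u; exact: itvT| |].
  apply/seteqP; split=> [_ [u ut <-]|u ut]; first exact: itv.
  by exists (star u); [exact: itv|rewrite starK //; exact: itvT ut].
have [k [tk Tkt <-]] := filter_ex (ev t Tt).
by have [] := (TsP k).1 t tk Tkt.
Qed.

End UltraLimit.

(** * Reduced forms and lengths *)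

Section ReducedForms.
Context (A : Type).
Implicit Types (w r : word A).

(** A form with comparisons only, which passes directly between a word and its restrictions. *)
Lemma ord_interval_or d (S : orderType d) (s t u : S) : ord_interval s t u <->
  (s <= u <= t)%O \/ (t <= u <= s)%O.
Proof.
case: (leP s t) => [st|/ltW ts].
  rewrite (ord_intervalE _ st); split=> [[-> ->]|]; first by left.
  case=> /andP[] //= tu us.
  by rewrite (le_trans st tu) (le_trans us st).
rewrite ord_intervalC (ord_intervalE _ ts); split=> [[-> ->]|]; first by right.
case=> /andP[] //= su ut.
by rewrite (le_trans ts su) (le_trans ut ts).
Qed.

(** Rules out crossing pairs: a pair that starts between [s] and [t] and ends outside spans one of
    these two endpoints. *)
Lemma ord_interval_crossing d (S : orderType d) (s t u v : S) :
  ord_interval s t u ->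
  [\/ ord_interval s t v, ord_interval u v s | ord_interval u v t].
Proof.
wlog st : s t / (s <= t)%O => [hw|].
  have [|/ltW ts] := leP s t; first exact: hw.
  rewrite ord_intervalC => /(hw _ _ ts)[|?|?]; last by constructor.
    by rewrite ord_intervalC; constructor.
  by constructor.
move=> /(ord_intervalE _ st)[su ut].
have [sv|/ltW vs] := leP s v; last first.
  by constructor 2; apply/ord_interval_or; right; rewrite vs su.
have [vt|/ltW tv] := leP v t.
  by constructor 1; apply/ord_interval_or; left; rewrite sv vt.
by constructor 3; apply/ord_interval_or; left; rewrite ut tv.
Qed.

(* The set of the pairs (t, star t): unlike the pairs (T, star), such graphs
   are ordered by inclusion, as Zorn's lemma requires. *)
Definition cancellation_graph w (G : set (wdom w * wdom w)) := forall s t,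
  G (s, t) ->
  [/\ G (t, s), forall t', G (s, t') -> t' = t, w t = linv (w s)
    & forall u, ord_interval s t u -> exists2 v, G (u, v) & ord_interval s t v].

Lemma maximal_cancellation_graph w : exists G : set (wdom w * wdom w),
  cancellation_graph G /\ forall H, G `<` H -> ~ cancellation_graph H.
Proof.
apply: Zorn_bigcup => F FG totF s t [G GF Gst].
have [Gts Gfun wst itv] := FG G GF s t Gst.
split=> //; first by exists G.
  move=> t' [H HF Hst']; have [GH|HG] := totF _ _ GF HF; last exact/Gfun/HG.
  by have [_ /(_ t (GH _ Gst))] := FG H HF s t' Hst'.
by move=> u /itv[v Guv ?]; exists v => //; exists G.
Qed.

(** Delete a maximal cancellation of [w]: any cancellation of what remains could be added to it. *)
Lemma reduced_form_exists w : exists r, reduced r /\ bf_class r = bf_class w.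
Proof.
have [G [wG Gmax]] := maximal_cancellation_graph w.
pose T : set (wdom w) := [set s | exists t, G (s, t)].
have /choice[star starP] s : exists t, T s -> G (s, t).
  by have [[t Gst]|] := pselect (T s); [exists t|exists s].
have Gstar s t : G (s, t) -> star s = t.
  move=> Gst; have [_ + _ _] := wG _ _ Gst; apply; apply: starP; by exists t.
have wT : cancellation T star.
  move=> t Tt; have [Gts Gfun wst itv] := wG _ _ (starP t Tt).
  split=> //; first by exists t.
  - exact: Gstar.
  - by move=> u /itv[v Guv _]; exists v.
  - apply/seteqP; split=> [_ [u /itv[v Guv vt] <-]|u /itv[v Guv vt]].
      by rewrite (Gstar u v).
    by exists v => //; apply: Gstar; have [] := wG _ _ Guv.
exists (wrestrict (~` T)); split; last first.
  apply/esym/eqmodP/asboolP; apply: rst_step; exists T, star; split=> //.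
  by exists id; split=> //; exists id.
move=> T' star' wT'; apply/seteqP; split=> // s0 T's0.
pose H := G `|` [set p | exists2 s, T' s & p = (sval s, sval (star' s))].
have GH s t : T s -> H (s, t) -> G (s, t).
  by move=> Ts [//|[s' _ [E _]]]; case: (svalP s'); rewrite -E.
case: (Gmax H).
  split=> [|HG]; first by move=> p; left.
  apply: (svalP s0); exists (sval (star' s0)); apply: HG; right.
  by exists s0.
move=> s t [Gst|[s' T's' [-> ->]]].
  have [Gts Gfun wst itv] := wG _ _ Gst.
  split=> //; first by left.
    by move=> t' /GH Gst'; apply/Gfun/Gst'; exists t.
  by move=> u /itv[v ? ?]; exists v => //; left.
have [T'st stK' itv' imitv' wst'] := wT' s' T's'.
split=> //.
- by right; exists (star' s') => //; rewrite stK'.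
- move=> t' [Gst'|[s1 _ [/eq_sig_hprop E ->]]].
    by case: (svalP s'); exists t'.
  by rewrite E // => ? ? ?; apply: Prop_irrelevance.
(* If [G] matches [u] with [v], then [v] stays in the interval, since otherwise the interval from
   [u] to [v] would contain an endpoint, which is unmatched in [G]. *)
move=> u us; have [[v Guv]|nTu] := pselect (T u).
  exists v; first by left.
  have [_ _ _ itv] := wG _ _ Guv.
  have [//||] := ord_interval_crossing v us => /itv[x Gx _].
    by case: (svalP s'); exists x.
  by case: (svalP (star' s')); exists x.
pose u' : wdom (wrestrict (~` T)) := exist _ u nTu.
have u's : ord_interval s' (star' s') u'.
  by apply/ord_interval_or; move/ord_interval_or: us.
exists (sval (star' u')).
  by right; exists u' => //; apply: itv'.
have : ord_interval s' (star' s') (star' u') by rewrite -imitv'; exists u'.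
by move=> /ord_interval_or us'; apply/ord_interval_or.
Qed.

End ReducedForms.

Lemma reduced_formP d (A : orderType d) (g : BF A) :
  reduced (reduced_form g) /\ bf_class (reduced_form g) = g.
Proof.
rewrite /reduced_form; apply: (@xgetPex _ (repr g)
  [set w | reduced w /\ bf_class w = g]).
have [r [rr rg]] := reduced_form_exists (repr g).
by exists r; split=> //; rewrite rg /bf_class reprK.
Qed.

(** * [L] and [c] as ultralimits of letter counts *)

Section LengthLimits.
Context (U : set_system nat) (U_ultra : UltraFilter U) (Uoo : \oo `<=` U).

Let U_proper : ProperFilter U := ultra_proper.
Local Existing Instance U_proper.

Context (d : Order.disp_t) (A : orderType d).
Context (f : A -> nat) (f' : nat -> A) (fK : cancel f f').
Implicit Types (g h r : BF A) (w : word A) (a b : A).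

Lemma lcount_wproj a k w : (f a < k)%N ->
  lcount a (wproj f k w) = lcount a (wproj f (f a).+1 w).
Proof using fK.
move=> ak; rewrite /lcount /wproj !count_map.
rewrite -(wpos_filter fK w ak) count_filter.
by apply: eq_count => s /=; case: eqP => //= ->; rewrite ltnSn.
Qed.

Lemma card_letter a w :
  #|` fset_set [set s | (w s).1 = a]| = lcount a (wproj f (f a).+1 w).
Proof using fK.
rewrite /lcount /wproj count_map -size_filter; apply/perm_size/uniq_perm.
- exact: fset_uniq.
- by rewrite filter_uniq // lt_sorted_uniq // wpos_sorted.
have fin : finite_set [set s | (w s).1 = a].
  apply: sub_finite_set (finite_index_lt fK (f a).+1 w).
  by move=> s /= ->.
move=> s; rewrite mem_filter (mem_wpos fK) (in_fset_set fin) /=.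
by apply/idP/andP => [|[/eqP ws _]]; rewrite inE //= => ->; rewrite eqxx.
Qed.

(** In the projections of the reduced form, the number of letters [a] is constant once [a] is
    visible, and free reduction removes none of them for [U]-many [k]. *)
Lemma bf_len_ultra g a : U [set k | (lcount a (bproj f k g))%:Z = bf_len g a].
Proof using U_ultra Uoo fK.
have [gred gcls] := reduced_formP g.
apply: filterS (filterI (ultra_ge Uoo (f a).+1)
  (reduced_lcount_wproj U_ultra Uoo fK a gred)) => k [ak /= E].
by rewrite /bf_len card_letter -(lcount_wproj _ ak) -E -(bproj_class fK) gcls.
Qed.

Lemma bf_len_class w a : reduced w ->
  bf_len (bf_class w) a = (lcount a (wproj f (f a).+1 w))%:Z.
Proof using U_ultra Uoo fK.
move=> wred; have [k [/= len_k [ak red_k]]] := filter_ex (filterI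
  (bf_len_ultra (bf_class w) a) (filterI (ultra_ge Uoo (f a).+1)
  (reduced_lcount_wproj U_ultra Uoo fK a wred))).
by rewrite -len_k (bproj_class fK) red_k lcount_wproj.
Qed.

(** Allows elements with equal projections to be exchanged inside lengths without an equality in the
    group. *)
Lemma bf_len_eq g h :
  (forall k, bproj f k g = bproj f k h) -> bf_len g = bf_len h.
Proof using U_ultra Uoo fK.
move=> gh; apply/funext => a; apply: (ultra_const U_ultra (bf_len_ultra g a)).
by under eq_set do rewrite gh; exact: bf_len_ultra.
Qed.

(** In each free group, L(g) + L(h) - L(g^-1 h) is twice the letter count of the common prefix; in
    particular the halving is exact. *)
Lemma bf_c_ultra g h a :
  U [set k | (lcount a (lcp (bproj f k g) (bproj f k h)))%:Z = bf_c g h a].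
Proof using U_ultra Uoo fK.
apply: filterS (filterI (bf_len_ultra g a) (filterI (bf_len_ultra h a)
  (bf_len_ultra (bf_mul (bf_inv g) h) a))) => k [/= gk [hk ghk]].
rewrite /bf_c !fctE -gk -hk -ghk (bproj_inv_mul fK).
have /(congr1 Posz) := count_freered_seqinv_cat (pred1 a)
  (@bproj_freely_reduced _ f k g) (@bproj_freely_reduced _ f k h).
rewrite -/(lcount _ _) !PoszD -muln2 PoszM => <-.
by rewrite addrAC subrr add0r mulzK.
Qed.

Lemma bf_cC g h : bf_c g h = bf_c h g.
Proof using U_ultra Uoo fK.
apply/funext => a; apply: (ultra_const U_ultra (bf_c_ultra g h a)).
by under eq_set do rewrite lcpC; exact: bf_c_ultra.
Qed.

Lemma bf_cxx g : bf_c g g = bf_len g.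
Proof using U_ultra Uoo fK.
apply/funext => a; apply: (ultra_const U_ultra (bf_c_ultra g g a)).
by under eq_set do rewrite lcpxx; exact: bf_len_ultra.
Qed.

(** Each [k] satisfies one of two prefix relations, and the ultrafilter selects one of them. The
    selection does not depend on the letter, so one alternative holds for all coordinates at
    once. *)
Lemma bf_c_ultrametric g h r :
  (forall a, bf_c g h a <= bf_c g r a) \/ (forall a, bf_c h r a <= bf_c g r a).
Proof using U_ultra Uoo fK.
have le_c x y z t :
    U [set k | prefix (lcp (bproj f k x) (bproj f k y))
                      (lcp (bproj f k z) (bproj f k t))] ->
    forall a, bf_c x y a <= bf_c z t a.
  move=> Up a; have [k [/= /prefixP[s ->]] [<- <-]] := filter_ex (filterI Up
    (filterI (bf_c_ultra x y a) (bf_c_ultra z t a))).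
  by rewrite lez_nat /lcount count_cat leq_addr.
have [|/le_c ?|/le_c ?] := ultra_or U_ultra
  (P := [set k | prefix (lcp (bproj f k g) (bproj f k h))
                        (lcp (bproj f k g) (bproj f k r))])
  (Q := [set k | prefix (lcp (bproj f k h) (bproj f k r))
                        (lcp (bproj f k g) (bproj f k r))]).
- by apply: filterE => k; apply/orP/lcp_ultrametric.
- by left.
- by right.
Qed.

End LengthLimits.

(** * The tree *)

Section LexOrder.
Context (d : Order.disp_t) (A : orderType d) (hA : order_type_omega A).
Implicit Types (s t u v : A -> int) (a b : A).

Lemma lexle_refl s : lexle s s. Proof. by left. Qed.

(** Order type omega provides a first letter at which [s] and [t] differ. *)
Lemma lexle_total s t : lexle s t \/ lexle t s.
Proof using hA.
case: hA => f [[f' fK f'K] f_mono].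
have [st|/existsNP[a /eqP sta]] := pselect (forall a, s a = t a).
  by left; left; apply/funext.
have exP : exists n, s (f' n) != t (f' n) by exists (f a); rewrite fK.
case: (ex_minnP exP) => n neq_n min_n.
have lt_n b : (b < f' n)%O -> s b = t b.
  rewrite (ltNge b) -f_mono f'K -ltNge => bn; apply/eqP/negPn/negP => stb.
  by have := min_n (f b); rewrite fK leqNgt => /(_ stb)/negP; apply.
have [lt_st|lt_ts|eq_st] := ltgtP (s (f' n)) (t (f' n)).
- by left; right; exists (f' n).
- by right; right; exists (f' n); split=> // b /lt_n.
- by rewrite eq_st eqxx in neq_n.
Qed.

Lemma lexle_trans s t u : lexle s t -> lexle t u -> lexle s u.
Proof.
case=> [->|[a [sta eqa]]] // [<-|[b [tub eqb]]]; first by right; exists a.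
right; have [ab|ba|eqab] := ltgtP a b.
- by exists a; split=> [|c ca]; rewrite -eqb // ?eqa //; apply: lt_trans ca ab.
- by exists b; split=> [|c cb]; rewrite eqa // ?eqb //; apply: lt_trans cb ba.
- rewrite -eqab in tub eqb.
  by exists a; split=> [|c ca]; [apply: lt_trans tub|rewrite eqa ?eqb].
Qed.

Lemma lexle_anti s t : lexle s t -> lexle t s -> s = t.
Proof.
case=> [//|[a [sta eqa]]] [//|[b [tsb eqb]]].
have [ab|ba|eqab] := ltgtP a b.
- by rewrite eqb ?ltxx in sta.
- by rewrite eqa ?ltxx in tsb.
- by rewrite eqab in sta; have := lt_trans sta tsb; rewrite ltxx.
Qed.

(** Reduces translations and rearrangements of lexicographic inequalities to integer arithmetic in
    each coordinate. *)
Lemma lexle_homo s t u v : (forall a, s a < t a -> u a < v a) ->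
  (forall a, s a = t a -> u a = v a) -> lexle s t -> lexle u v.
Proof.
move=> lt_uv eq_uv [st|[a [sta eqa]]].
  by left; apply/funext => a; apply: eq_uv; rewrite st.
by right; exists a; split=> [|b /eqa]; [exact: lt_uv|exact: eq_uv].
Qed.

Lemma lexle_pointwise s t : (forall a, s a <= t a) -> lexle s t.
Proof using hA.
move=> st; have [//|[->|[a [tsa _]]]] := lexle_total s t; first by left.
by have := st a; rewrite leNgt tsa.
Qed.

Lemma lexmin_l s t : lexle s t -> lexmin s t = s.
Proof. by move=> st; rewrite /lexmin asboolT. Qed.

Lemma lexmin_r s t : lexle t s -> lexmin s t = t.
Proof. by rewrite /lexmin; case: asboolP => // st ts; apply: lexle_anti. Qed.

Lemma lexmin_lel s t : lexle (lexmin s t) s.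
Proof using hA.
have [/lexmin_l ->|ts] := lexle_total s t; first exact: lexle_refl.
by rewrite lexmin_r.
Qed.

Lemma lexmin_ler s t : lexle (lexmin s t) t.
Proof using hA.
have [st|/lexmin_r ->] := lexle_total s t; last exact: lexle_refl.
by rewrite lexmin_l.
Qed.

Lemma le_lexmin s t u : lexle s t -> lexle s u -> lexle s (lexmin t u).
Proof. by rewrite /lexmin; case: asboolP. Qed.

Lemma lexabs_ge s t : lexle t s -> lexabs (s - t) = s - t.
Proof.
move=> ts; rewrite /lexabs asboolT //.
apply: lexle_homo ts => a; rewrite !fctE ?subr_gt0 // => ->.
by rewrite subrr.
Qed.

Lemma lexabs_le s t : lexle s t -> lexabs (s - t) = t - s.
Proof.
move=> st; rewrite /lexabs opprB; case: asboolP => // st0.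
suff ts : lexle t s by rewrite (lexle_anti st ts).
apply: lexle_homo st0 => a; rewrite !fctE ?subr_gt0 // => /esym/eqP.
by rewrite subr_eq0 => /eqP.
Qed.

End LexOrder.

(** * Points, distances and segments of the tree *)

Section Tree.
Context (U : set_system nat) (U_ultra : UltraFilter U) (Uoo : \oo `<=` U).
Context (d : Order.disp_t) (A : orderType d) (hA : order_type_omega A).
Context (f : A -> nat) (f' : nat -> A) (fK : cancel f f').
Implicit Types (g h r v u w : BF A) (n m s t : A -> int).
Implicit Types (p q : prepoint A).

Let bf_cC := bf_cC U_ultra Uoo fK.
Let bf_cxx := bf_cxx U_ultra Uoo fK.

(** This consequence of the ultrametric inequality makes [identified] transitive. *)
Lemma lexle_c_trans n g h r :
  lexle n (bf_c g h) -> lexle n (bf_c h r) -> lexle n (bf_c g r).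
Proof using hA U_ultra Uoo fK.
move=> ngh nhr; have [/lexle_pointwise|/lexle_pointwise] :=
  bf_c_ultrametric U_ultra Uoo fK g h r => /(_ hA).
  exact: lexle_trans.
exact: lexle_trans.
Qed.

Lemma identified_refl p : identified p p.
Proof using U_ultra Uoo fK.
by split=> //; rewrite bf_cxx; have := valP p; rewrite inE => -[].
Qed.

Lemma identified_sym p q : identified p q -> identified q p.
Proof using U_ultra Uoo fK. by case=> e; rewrite /identified -e bf_cC. Qed.

Lemma identified_trans p q p' :
  identified p q -> identified q p' -> identified p p'.
Proof using hA U_ultra Uoo fK.
case=> e pq [e' qp']; split; first by rewrite e.
by apply: lexle_c_trans pq _; rewrite e.
Qed.

Lemma tree_eqP p q : \pi_(tree A) p = \pi_(tree A) q <-> identified p q.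
Proof using hA U_ultra Uoo fK.
split=> [/eqmodP/asboolP|pq]; last by apply/eqmodP/asboolP; apply: rst_step.
elim=> // [x|x y _|x y z _ xy _].
- exact: identified_refl.
- exact: identified_sym.
- exact: identified_trans.
Qed.

Lemma identified_repr p : identified p (repr (\pi_(tree A) p)).
Proof using hA U_ultra Uoo fK. by apply/tree_eqP; rewrite reprK. Qed.

Lemma dist_along p q : preelt p = preelt q ->
  dist (\pi_(tree A) p) (\pi_(tree A) q) = lexabs (preheight p - preheight q).
Proof using hA U_ultra Uoo fK.
move=> pq; rewrite /dist /predist.
have [<- cp] := identified_repr p; have [<- cq] := identified_repr q.
set p' := repr _ in cp *; set q' := repr _ in cq *.
(* Each chosen representative agrees with the common element up to its own height, so the two agree
   with each other up to the smaller height. *)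
have c_le t : lexle t (preheight p) -> lexle t (preheight q) ->
    lexle t (bf_c (preelt p') (preelt q')).
  move=> tp tq; apply: (@lexle_c_trans _ _ (preelt p)).
    by rewrite bf_cC; apply: lexle_trans cp.
  by rewrite pq; apply: lexle_trans cq.
have [le_pq|le_qp] := lexle_total hA (preheight p) (preheight q).
  rewrite lexmin_l; last first.
    by apply: le_lexmin => //; apply: c_le => //; apply: lexle_refl.
  rewrite lexabs_le // mulr2n; apply/funext => a; rewrite !fctE; lia.
rewrite (@lexmin_l _ _ (preheight q)); last first.
  by apply: c_le => //; apply: lexle_refl.
rewrite lexmin_r // lexabs_ge // mulr2n; apply/funext => a; rewrite !fctE; lia.
Qed.

Lemma tree_point_eq n m g h (hn : n \in lex_interval 0 (bf_len g))
    (hm : m \in lex_interval 0 (bf_len h)) :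
  n = m -> lexle n (bf_c g h) -> tree_point hn = tree_point hm.
Proof using hA U_ultra Uoo fK. by move=> nm c; apply/tree_eqP. Qed.

Lemma repr_vertex g : preheight (repr (vertex hA g)) = bf_len g /\
  lexle (bf_len g) (bf_c g (preelt (repr (vertex hA g)))).
Proof using U_ultra Uoo fK.
by have [<- cg] :=
  identified_repr (exist _ (bf_len g, g) (vertex_subproof hA g)).
Qed.

(** * Segments from [v] to an element [u] of which [v] is a prefix, as [c_vu] expresses *)

Section SegmentToPrefix.
Context (v u : BF A) (c_vu : bf_c v u = bf_len v).
Context (le_vu : lexle (bf_len v) (bf_len u)).

Lemma interval_prefix n : lex_interval (bf_len v) (bf_len u) n ->
  n \in lex_interval 0 (bf_len u).
Proof using hA.
case=> vn nu; rewrite inE; split=> //.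
exact: lexle_trans (lexle0_bf_len hA v) vn.
Qed.

Lemma vertex_prefix (hv : bf_len v \in lex_interval 0 (bf_len u)) :
  vertex hA v = tree_point hv.
Proof using U_ultra Uoo fK c_vu.
by apply: tree_point_eq => //; rewrite c_vu; apply: lexle_refl.
Qed.

(** Parametrize by height along [u]. Existence ensures that [segment] is a genuine segment and not
    the default [set0]. *)
Lemma is_segment_prefix : exists Sg, is_segment (vertex hA v) (vertex hA u) Sg.
Proof using U_ultra Uoo fK c_vu le_vu.
pose pt s := if pselect (lex_interval (bf_len v) (bf_len u) s) is left e
  then tree_point (interval_prefix e) else vertex hA u.
have ptE s (e : lex_interval (bf_len v) (bf_len u) s) :
    pt s = tree_point (interval_prefix e).
  rewrite /pt; case: pselect => // e'; congr tree_point.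
  exact: bool_irrelevance.
exists (pt @` lex_interval (bf_len v) (bf_len u)), (bf_len v), (bf_len u), pt.
have ev : lex_interval (bf_len v) (bf_len u) (bf_len v) by split=> //; left.
have eu : lex_interval (bf_len v) (bf_len u) (bf_len u) by split=> //; left.
split=> // [s t es et||].
- by rewrite (ptE _ es) (ptE _ et) dist_along.
- by rewrite (ptE _ ev) -vertex_prefix.
- by rewrite (ptE _ eu); apply: tree_point_eq => //; rewrite bf_cxx; left.
Qed.

(** Works for whichever segment is chosen: the distances of a point to both ends force its height
    and its agreement with [u] up to that height. *)
Lemma mem_segment_prefix n w (hn : n \in lex_interval 0 (bf_len w)) :
  lex_interval (bf_len v) (bf_len u) n -> lexle n (bf_c w u) ->
  tree_point hn \in segment (vertex hA v) (vertex hA u).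
Proof using U_ultra Uoo fK c_vu le_vu.
move=> n_vu n_wu; rewrite inE.
have : is_segment (vertex hA v) (vertex hA u)
         (segment (vertex hA v) (vertex hA u)).
  exact: (xgetPex set0 is_segment_prefix).
case=> a [b [F [le_ab distF Fa Fb ->]]].
have aI : lex_interval a b a by split=> //; left.
have bI : lex_interval a b b by split=> //; left.
have [le_vn le_nu] := n_vu.
have vI : lex_interval (bf_len v) (bf_len u) (bf_len v) by split=> //; left.
have ab : b - a = bf_len u - bf_len v.
  rewrite -lexabs_le // -(distF _ _ aI bI) Fa Fb.
  by rewrite (vertex_prefix (interval_prefix vI)) dist_along // lexabs_le.
have {}ab i : b i - a i = bf_len u i - bf_len v i := congr1 (@^~ i) ab.
(* The parameter whose image lies at distance [n - bf_len v] from the vertex [v]. *)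
pose x := a + (n - bf_len v).
have le_ax : lexle a x by apply: lexle_homo le_vn => i; rewrite /x !fctE; lia.
have le_xb : lexle x b.
  by apply: lexle_homo le_nu => i; have := ab i; rewrite /x !fctE; lia.
have xI : lex_interval a b x by split.
exists x => //; rewrite -[F x]reprK.
have := distF _ _ xI bI; have := distF _ _ xI aI.
rewrite lexabs_ge // lexabs_le // Fa Fb /dist /predist.
set q := repr (F x).
(* If q has height m, then m + L(u) - 2k = L(u) - n and
   m + L(v) - 2k' = n - L(v), where k <= m and k' <= L(v); so m = n = k. *)
have [-> _] := repr_vertex v; have [-> c_u] := repr_vertex u.
set cv := bf_c _ _; set cu := bf_c _ _.
have := lexmin_lel hA (preheight q) (lexmin (bf_len u) cu).
have := lexmin_ler hA (preheight q) (lexmin (bf_len u) cu).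
have := lexmin_ler hA (preheight q) (lexmin (bf_len v) cv).
set k := lexmin _ (lexmin (bf_len u) _).
set k' := lexmin _ (lexmin (bf_len v) _).
move=> /lexle_trans/(_ (lexmin_lel hA _ _)) k'_v k_u k_q dist_v dist_u.
have {}dist_v i : preheight q i + bf_len v i - k' i *+ 2 = x i - a i :=
  congr1 (@^~ i) dist_v.
have {}dist_u i : preheight q i + bf_len u i - k i *+ 2 = b i - x i :=
  congr1 (@^~ i) dist_u.
have xE i : x i = a i + (n i - bf_len v i) by [].
have qn : preheight q = n.
  apply: lexle_anti.
    by apply: lexle_homo k'_v => i; have := dist_v i; rewrite xE; lia.
  by apply: lexle_homo k_q => i;
    have := dist_u i; have := ab i; rewrite xE; lia.
have kn : k = n.
  apply/funext => i; have := dist_u i; have := ab i; rewrite xE qn; lia.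
apply/tree_eqP; split=> //=; rewrite qn.
(* Agreement up to [n] is chained from [q] through the representative of the vertex [u] and [u]
   itself to [w]. *)
apply: (@lexle_c_trans _ _ u); last by rewrite bf_cC.
apply: (@lexle_c_trans _ _ (preelt (repr (vertex hA u)))).
  by rewrite -kn; apply: (lexle_trans k_u); apply: lexmin_ler.
by rewrite bf_cC; apply: lexle_trans le_nu c_u.
Qed.

End SegmentToPrefix.
End Tree.

(** * Prefixes of a reduced word *)

Definition convex d (S : orderType d) (D : set S) :=
  forall s t u, D s -> D t -> (s <= u)%O -> (u <= t)%O -> D u.

(** By convexity, the intervals of [r] between positions of [D] are intervals of the restriction, so
    a cancellation of the restriction is one of [r]. *)
Lemma reduced_wrestrict A (r : word A) (D : set (wdom r)) :
  reduced r -> convex D -> reduced (wrestrict D).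
Proof.
move=> rred cD T star rT; apply/seteqP; split=> // s0 Ts0.
pose T' : set (wdom r) := [set s | exists2 s', T s' & s = sval s'].
pose star' s := if pselect (D s) is left e
  then sval (star (exist _ s e : wdom (wrestrict D))) else s.
have star'E (s : wdom (wrestrict D)) : star' (sval s) = sval (star s).
  case: s => s Ds; rewrite /star' /=; case: pselect => // e.
  by rewrite (Prop_irrelevance e Ds).
suff rT' : cancellation T' star'.
  by have : T' (sval s0) by [exists s0]; rewrite (rred _ _ rT').
move=> _ [s Ts ->]; have [Tst stK itv imitv wst] := rT s Ts.
have lift u : ord_interval (sval s) (sval (star s)) u ->
    exists2 u', u = sval u' & ord_interval s (star s) u'.
  move=> /ord_interval_or us; have Du : D u.
    by case: us => /andP[];
      [apply: cD (svalP s) _|apply: cD (svalP (star s)) _]; exact: svalP.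
  by exists (exist _ u Du) => //; apply/ord_interval_or.
rewrite !star'E; split=> //.
- by exists (star s).
- by rewrite stK.
- by move=> u /lift[u' -> /itv]; exists u'.
apply/seteqP; split=> [_ [u /lift[u' -> us] <-]|u /lift[u' -> us]].
  rewrite star'E.
  have : ord_interval s (star s) (star u') by rewrite -imitv; exists u'.
  by move=> /ord_interval_or us'; apply/ord_interval_or.
move: us; rewrite -{1}imitv => -[v vs <-].
exists (sval v); last by rewrite star'E.
by move/ord_interval_or: vs => vs; apply/ord_interval_or.
Qed.

Lemma seq_max d (S : orderType d) (l : seq S) : l != [::] ->
  exists2 s, s \in l & forall t, t \in l -> (t <= s)%O.
Proof.
elim: l => // x [_ _|y l /(_ isT)[s sl smax] _].
  by exists x => [|t]; rewrite ?inE // => /eqP ->.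
have [xs|/ltW sx] := leP x s.
  exists s => [|t]; first by rewrite inE sl orbT.
  by rewrite inE => /orP[/eqP -> //|/smax].
exists x => [|t]; first exact: mem_head.
by rewrite inE => /orP[/eqP -> //|/smax /le_trans]; apply.
Qed.

Lemma seq_min d (S : orderType d) (l : seq S) : l != [::] ->
  exists2 s, s \in l & forall t, t \in l -> (s <= t)%O.
Proof. exact: (@seq_max _ (S^d)%type). Qed.

Lemma wproj_wrestrictU (A : eqType) (f : A -> nat) f' (fK : cancel f f') k
    (r : word A) (D E : set (wdom r)) :
  (forall s t, D s -> E t -> (s < t)%O) ->
  wproj f k (wrestrict (D `|` E)) =
  wproj f k (wrestrict D) ++ wproj f k (wrestrict E).
Proof.
move=> DE; rewrite !(wproj_wrestrict fK) -map_cat; congr map.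
apply: lt_sorted_eq => [||s]; first exact/lt_sorted_filter/wpos_sorted.
  rewrite lt_sorted_pairwise pairwise_cat -!lt_sorted_pairwise.
  rewrite !lt_sorted_filter ?wpos_sorted // !andbT.
  apply/allrelP => s t; rewrite !mem_filter.
  by move=> /andP[/asboolP Ds _] /andP[/asboolP Et _]; exact: DE.
by rewrite mem_cat !mem_filter asbool_or andb_orl.
Qed.

Lemma wproj_wrestrict1 (A : eqType) (f : A -> nat) f' (fK : cancel f f') k
    (r : word A) (s : wdom r) :
  wproj f k (wrestrict [set s]) = wproj f k (wsingle (r s)).
Proof.
rewrite (wproj_wrestrict fK).
rewrite (@wproj_embedding _ f f' fK k (wsingle (r s)) r (fun=> s)) //.
  2: by move=> t u; rewrite lexx.
congr map; apply: eq_filter => t; apply/asboolP/asboolP => [->|[_ ->] //].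
by exists tt.
Qed.

(** * Lengths of products and appended generators *)

Section Multiplication.
Context (U : set_system nat) (U_ultra : UltraFilter U) (Uoo : \oo `<=` U).

Let U_proper : ProperFilter U := ultra_proper.
Local Existing Instance U_proper.

Context (d : Order.disp_t) (A : orderType d).
Context (f : A -> nat) (f' : nat -> A) (fK : cancel f f').
Implicit Types (g h r v x : BF A) (w : word A) (a : A) (b : bool).

Let bf_len_eq := bf_len_eq U_ultra Uoo fK.

Lemma bf_len_inv g : bf_len (bf_inv g) = bf_len g.
Proof using U_ultra Uoo fK.
apply/funext => a.
apply: (ultra_const U_ultra _ (bf_len_ultra U_ultra Uoo fK g a)).
apply: filterS (bf_len_ultra U_ultra Uoo fK (bf_inv g) a) => k /= <-.
rewrite (bproj_inv fK) -(cats0 (seqinv _)).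
have := count_freered_seqinv_cat (pred1 a) (bproj_freely_reduced f k g)
  (isT : freely_reduced [::]).
by rewrite /lcount lcps0 !addn0 => ->.
Qed.

Lemma bf_c_eqr g h h' : (forall k, bproj f k h = bproj f k h') ->
  bf_c g h = bf_c g h'.
Proof using U_ultra Uoo fK.
move=> hh'; rewrite /bf_c (bf_len_eq hh').
rewrite (@bf_len_eq (bf_mul (bf_inv g) h) (bf_mul (bf_inv g) h')) // => k.
by rewrite !(bproj_inv_mul fK) hh'.
Qed.

(** Cancelling [v] leaves [x], so additivity of the lengths makes [v] a prefix of the product. *)
Lemma bf_c_mul v x : bf_len (bf_mul v x) = bf_len v + bf_len x ->
  bf_c v (bf_mul v x) = bf_len v.
Proof using U_ultra Uoo fK.
move=> len; apply/funext => a; rewrite /bf_c len.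
rewrite (@bf_len_eq (bf_mul (bf_inv v) (bf_mul v x)) x) => [|k].
  rewrite !fctE; lia.
rewrite (bproj_inv_mul fK) (bproj_mul fK) freered_catr freered_seqinvK.
exact: freered_idem.
Qed.

Lemma bproj_gen_sign k a (b : bool) :
  bproj f k (if b then bf_inv (bf_gen a) else bf_gen a) =
  freered (wproj f k (wsingle (a, b))).
Proof using fK.
case: b; last exact: (bproj_class fK).
rewrite (bproj_inv fK) (bproj_class fK) -[seqinv _]cats0 freered_seqinv_catl.
rewrite cats0 -(wproj_winv fK); congr freered.
Qed.

Lemma bf_len_gen_sign a (b : bool) c :
  bf_len (if b then bf_inv (bf_gen a) else bf_gen a) c = (a == c)%:Z.
Proof using U_ultra Uoo fK.
apply: (ultra_const U_ultra (bf_len_ultra U_ultra Uoo fK _ c)).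
apply: filterS (ultra_ge Uoo (f a).+1) => k /= ak.
by rewrite bproj_gen_sign (wproj_wsingle fK) // /lcount /= addn0.
Qed.

(** In each projection at least one sign appends without cancellation; the ultrafilter selects a
    single sign. *)
Lemma bf_len_mul_gen_sign v a : exists b : bool,
  let x := if b then bf_inv (bf_gen a) else bf_gen a in
  bf_len (bf_mul v x) = bf_len v + bf_len x.
Proof using U_ultra Uoo fK.
have len b : U [set k | freely_reduced (rcons (bproj f k v) (a, b))] ->
    let x := if b then bf_inv (bf_gen a) else bf_gen a in
    bf_len (bf_mul v x) = bf_len v + bf_len x.
  move=> Ub x; apply/funext => c; rewrite fctE.
  have len_c g := bf_len_ultra U_ultra Uoo fK g c.
  have [k [/= red [ak [<- [<- <-]]]]] := filter_ex (filterI Ub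
    (filterI (ultra_ge Uoo (f a).+1)
      (filterI (len_c (bf_mul v x)) (filterI (len_c v) (len_c x))))).
  rewrite (bproj_mul fK) bproj_gen_sign (wproj_wsingle fK) // freered_catr.
  by rewrite cats1 freered_id // -cats1 /lcount count_cat.
have [/len|/len] := ultra_or U_ultra
  (P := [set k | freely_reduced (rcons (bproj f k v) (a, false))])
  (Q := [set k | freely_reduced (rcons (bproj f k v) (a, true))])
  (filterE _ (fun k => freely_reduced_rcons (a, false)
                         (bproj_freely_reduced f k v))).
- by exists false.
- by exists true.
Qed.

End Multiplication.

(** * Cutting a reduced word at height [n] *)

Section Prefixes.
Context (U : set_system nat) (U_ultra : UltraFilter U) (Uoo : \oo `<=` U).
Context (d : Order.disp_t) (A : orderType d) (hA : order_type_omega A).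
Context (f : A -> nat) (f' : nat -> A) (fK : cancel f f').
Context (f_mono : {mono f : x y / (x <= y)%O}).
Context (r : word A) (r_red : reduced r).
Implicit Types (D E : set (wdom r)) (s t : wdom r) (a b : A) (n : A -> int).

Let g := bf_class r.
Let prefix D : BF A := bf_class (wrestrict D).

Lemma prefix_len D a : convex D -> bf_len (prefix D) a =
  (count (fun s => ((r s).1 == a) && `[< D s >]) (wpos f (f a).+1 r))%:Z.
Proof using U_ultra Uoo fK r_red.
move=> cD; rewrite (bf_len_class U_ultra Uoo fK); last exact: reduced_wrestrict.
by rewrite (wproj_wrestrict fK) /lcount count_map count_filter.
Qed.

Lemma prefix_len_le D E a : convex D -> convex E -> D `<=` E ->
  bf_len (prefix D) a <= bf_len (prefix E) a.
Proof using U_ultra Uoo fK r_red.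
move=> cD cE DE; rewrite !prefix_len // lez_nat; apply: sub_count => s /=.
by move=> /andP[->] /asboolP /DE ?; apply/asboolP.
Qed.

Lemma prefix_len_eq D E a : convex D -> convex E ->
  (forall s, (r s).1 = a -> D s <-> E s) ->
  bf_len (prefix D) a = bf_len (prefix E) a.
Proof using U_ultra Uoo fK r_red.
move=> cD cE DE; rewrite !prefix_len //; congr Posz; apply: eq_count => s /=.
by case: eqP => //= rs; apply/asboolP/asboolP => /(DE s rs).
Qed.

Definition downset D := forall s t, D t -> (s <= t)%O -> D s.

Lemma downset_convex D : downset D -> convex D.
Proof. by move=> dD s t u _ Dt _; apply: dD. Qed.

Lemma upset_convex D : downset D -> convex (~` D).
Proof. by move=> dD s t u nDs _ su _ /dD/(_ su). Qed.

Definition below s : set (wdom r) := [set t | (t <= s)%O].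

Lemma downset_below s : downset (below s).
Proof. by move=> t u /= us tu; apply: le_trans us. Qed.

Lemma convexT : convex (setT : set (wdom r)). Proof. by []. Qed.

Lemma len_setT : bf_len (prefix setT) = bf_len g.
Proof using U_ultra Uoo fK.
apply: (bf_len_eq U_ultra Uoo fK) => k.
rewrite !(bproj_class fK) (wproj_wrestrict fK); congr (freered (map _ _)).
by apply/all_filterP/allP => s _; apply/asboolP.
Qed.

Lemma wproj_prefix k D : downset D ->
  wproj f k r = wproj f k (wrestrict D) ++ wproj f k (wrestrict (~` D)).
Proof using fK.
move=> dD; rewrite -(wproj_wrestrictU fK); last first.
  by move=> s t Ds nDt; rewrite ltNge; apply/negP => /(dD t s Ds).
rewrite setUv (wproj_wrestrict fK) /wproj; congr map.
by apply/esym/all_filterP/allP => s _; apply/asboolP.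
Qed.

Lemma bf_c_prefix D : downset D -> bf_c g (prefix D) = bf_len (prefix D).
Proof using U_ultra Uoo fK r_red.
move=> dD; apply/funext => a; rewrite /bf_c !fctE.
(* In every projection [g] is [prefix D] followed by the complementary tail, so the product reduces
   to the inverse of that tail. *)
have -> : bf_len (bf_mul (bf_inv g) (prefix D)) = bf_len (prefix (~` D)).
  rewrite -[RHS](bf_len_inv U_ultra Uoo fK).
  apply: (bf_len_eq U_ultra Uoo fK) => k.
  rewrite (bproj_inv_mul fK) (bproj_inv fK) !(bproj_class fK).
  rewrite freered_catr freered_seqinv_catl (wproj_prefix k dD) seqinv_cat -catA.
  rewrite -[in RHS](cats0 (seqinv _)) freered_seqinv_catl -freered_catr.
  by rewrite -[_ ++ wproj _ _ _]cats0 -catA freered_seqinvK.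
have -> : bf_len g a = bf_len (prefix D) a + bf_len (prefix (~` D)) a.
  rewrite -len_setT !prefix_len //;
    try by [apply: downset_convex|apply: upset_convex].
  rewrite -PoszD -count_predUI; congr Posz.
  rewrite -[LHS]addn0; congr addn.
    apply: eq_count => s /=; case: eqP => //= _.
    by rewrite asboolT // -asbool_or asboolT //; exact: EM.
  apply/esym/eqP; rewrite -leqn0 leqNgt -has_count; apply/hasPn => s _ /=.
  by rewrite andbACA -asbool_and asboolF ?andbF // => -[].
lia.
Qed.

Lemma prefix_len_add1 D s a : downset D -> downset (D `|` [set s]) -> ~ D s ->
  bf_len (prefix (D `|` [set s])) a = bf_len (prefix D) a + ((r s).1 == a)%:Z.
Proof using U_ultra Uoo fK r_red.
move=> dD dDs nDs.
have lt_s t u : D t -> [set s] u -> (t < u)%O.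
  by move=> Dt ->; rewrite ltNge; apply/negP => /(dD s t Dt).
rewrite !(bf_len_class U_ultra Uoo fK);
  try by apply: reduced_wrestrict => //; apply: downset_convex.
rewrite (wproj_wrestrictU fK) // (wproj_wrestrict1 fK) /lcount count_cat PoszD.
congr (_ + _); case: eqP => [<-|/eqP nsa].
  by rewrite (wproj_wsingle fK) //= eqxx.
congr Posz; apply/eqP; rewrite -leqn0 leqNgt -has_count /wproj has_map.
by apply/hasPn => -[] _ /=.
Qed.

Lemma bproj_prefix_add1 k D s : downset D -> ~ D s ->
  bproj f k (prefix (D `|` [set s])) =
  bproj f k (bf_mul (prefix D)
    (if (r s).2 then bf_inv (bf_gen (r s).1) else bf_gen (r s).1)).
Proof using fK.
move=> dD nDs; rewrite (bproj_mul fK) (bproj_gen_sign fK) !(bproj_class fK).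
rewrite freered_catl freered_catr (wproj_wrestrictU fK); last first.
  by move=> t u Dt ->; rewrite ltNge; apply/negP => /(dD s t Dt).
by rewrite (wproj_wrestrict1 fK) -surjective_pairing.
Qed.


(** Otherwise [prefix D] first exceeds [n] at some letter [j]. Only finitely many positions of [D]
    carry letters up to [j]; stopping at the last of them gives the same counts up to [j], hence a
    prefix that is already too long. If there are none, [n] would be negative. *)
Lemma prefix_below n : lexle 0 n -> forall D, downset D ->
  (forall s, D s -> lexle (bf_len (prefix (below s))) n) ->
  lexle (bf_len (prefix D)) n.
Proof using U_ultra Uoo hA fK f_mono r_red.
move=> n0 D dD Dn.
have [//|[->|[j [nj eqj]]]] := lexle_total hA (bf_len (prefix D)) n.
  exact: lexle_refl.
exfalso; pose l := [seq s <- wpos f (f j).+1 r | `[< D s >]].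
have mem_l b s : (b <= j)%O -> (r s).1 = b -> D s -> s \in l.
  move=> bj rs Ds; rewrite mem_filter asboolT //= (mem_wpos fK) rs ltnS.
  by rewrite -leEnat f_mono.
have not_above m : lexle m n ->
    ~ (n j < m j /\ forall b, (b < j)%O -> n b = m b).
  move=> mn [nmj nmb]; have nm : lexlt n m by exists j.
  by move: nmj; rewrite (lexle_anti mn (or_intror nm)) ltxx.
have [l0|/seq_max[s sl smax]] := eqVneq l [::].
  have D0 b : (b <= j)%O -> bf_len (prefix D) b = 0.
    move=> bj; rewrite prefix_len; last exact: downset_convex.
    congr Posz; apply/eqP; rewrite -leqn0 leqNgt -has_count.
    apply/hasPn => s _ /=.
    by case: eqP => //= rs; apply/asboolP => /(mem_l b s bj rs); rewrite l0.
  apply: (not_above 0 n0); split=> [|b bj]; first by rewrite D0 in nj.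
  by rewrite eqj // D0 // ltW.
have Ds : D s by move: sl; rewrite mem_filter => /andP[/asboolP].
have eqb b : (b <= j)%O -> bf_len (prefix (below s)) b = bf_len (prefix D) b.
  move=> bj; apply: prefix_len_eq => [||t rt].
  - exact: (downset_convex (@downset_below s)).
  - exact: (downset_convex dD).
  - by split=> [ts|Dt]; [exact: dD Ds ts|exact/smax/(mem_l b)].
apply: (not_above _ (Dn s Ds)); split=> [|b bj]; first by rewrite eqb.
by rewrite eqb ?eqj // ltW.
Qed.

(** Otherwise [prefix D] first falls short of [n] at some letter [j]. Only finitely many positions
    outside [D] carry letters up to [j], so a prefix slightly longer than [D] has the same counts up
    to [j] and is still too short. If there are none, the whole word is too short. *)
Lemma prefix_above n : lexle n (bf_len g) -> forall D, downset D ->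
  (forall s, ~ D s -> exists2 t, ~ D t & (t < s)%O) ->
  (forall s, ~ D s -> lexle n (bf_len (prefix (below s)))) ->
  lexle n (bf_len (prefix D)).
Proof using U_ultra Uoo hA fK f_mono r_red.
move=> ng D dD nmin Dn.
have [//|[->|[j [jn eqj]]]] := lexle_total hA n (bf_len (prefix D)).
  exact: lexle_refl.
exfalso; pose l := [seq s <- wpos f (f j).+1 r | ~~ `[< D s >]].
have mem_l b s : (b <= j)%O -> (r s).1 = b -> ~ D s -> s \in l.
  move=> bj rs Ds; rewrite mem_filter asboolF //= (mem_wpos fK) rs ltnS.
  by rewrite -leEnat f_mono.
have not_below E : convex E -> lexle n (bf_len (prefix E)) ->
    ~ forall s, s \in wpos f (f j).+1 r -> D s <-> E s.
  move=> cE nE DE.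
  have eqb b : (b <= j)%O -> bf_len (prefix D) b = bf_len (prefix E) b.
    move=> bj; apply: prefix_len_eq => //; first exact: downset_convex.
    by move=> s rs; apply: DE; rewrite (mem_wpos fK) rs ltnS -leEnat f_mono.
  have En : lexlt (bf_len (prefix E)) n.
    exists j; split=> [|b bj]; first by rewrite -eqb.
    by rewrite -eqb ?eqj // ltW.
  by case: (En) => i []; rewrite (lexle_anti nE (or_intror En)) ltxx.
have [l0|/seq_min[s sl smin]] := eqVneq l [::].
  apply: (not_below setT (@convexT)); first by rewrite len_setT.
  move=> s sf; split=> // _; apply: contrapT => nDs.
  have := mem_l _ s _ erefl nDs; rewrite l0 -f_mono leEnat -ltnS.
  by rewrite -(mem_wpos fK) => /(_ sf).
have nDs : ~ D s by move: sl; rewrite mem_filter => /andP[/asboolPn].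
(* Stopping at [t], strictly before [s], adds to [D] no letter up to [j]. *)
have [t nDt ts] := nmin s nDs.
apply: (not_below _ (downset_convex (@downset_below t)) (Dn t nDt)) => u uf.
split=> [Du|/= ut].
  by rewrite /below /= leNgt; apply/negP => /ltW /(dD t u Du).
apply: contrapT => nDu; have : u \in l by rewrite mem_filter asboolF.
by move=> /smin su; have := lt_le_trans ts (le_trans su ut); rewrite ltxx.
Qed.

(** Supplies the hypotheses of [mem_segment_prefix]: [v] is a prefix of [u], [n] lies between their
    lengths, and [g] agrees with [u] up to [n]. *)
Lemma prefix_segment n : lexle 0 n -> lexle n (bf_len g) ->
  exists v a (b : bool),
  let u := bf_mul v (if b then bf_inv (bf_gen a) else bf_gen a) in
  [/\ bf_c v u = bf_len v, lexle (bf_len v) n, lexle n (bf_len u)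
    & lexle n (bf_c g u)].
Proof using U_ultra Uoo hA fK f_mono r_red.
move=> n0 ng.
pose D : set (wdom r) := [set s | lexle (bf_len (prefix (below s))) n].
have dD : downset D.
  move=> s t Dt st; apply: lexle_trans Dt; apply: lexle_pointwise => // a.
  apply: prefix_len_le; last by move=> u /= us; apply: le_trans st.
    exact: (downset_convex (@downset_below s)).
  exact: (downset_convex (@downset_below t)).
have Dn : lexle (bf_len (prefix D)) n by apply: prefix_below.
have nDn s : ~ D s -> lexle n (bf_len (prefix (below s))).
  by have [|] := lexle_total hA n (bf_len (prefix (below s))).
have [[s nDs smin]|nmin] :=
    pselect (exists2 s, ~ D s & forall t, ~ D t -> (s <= t)%O).
  exists (prefix D), (r s).1, (r s).2; set x := (if _ then _ else _) => u.
  have DsE : D `|` [set s] = below s.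
    apply/seteqP; split=> [t [Dt|-> /=]|t /= ts]; [|exact: lexx|].
      by rewrite /below /= leNgt; apply/negP => /ltW /(dD s t Dt).
    have [|nDt] := pselect (D t); first by left.
    by right; apply/le_anti; rewrite smin // andbT; exact: ts.
  have dDs : downset (D `|` [set s]) by rewrite DsE; exact: downset_below.
  have uE k : bproj f k (prefix (D `|` [set s])) = bproj f k u.
    exact: bproj_prefix_add1.
  have len_u := bf_len_eq U_ultra Uoo fK uE.
  have c_u := bf_c_eqr U_ultra Uoo fK g uE.
  split=> //; rewrite -?len_u -?c_u ?bf_c_prefix // ?DsE; try exact: nDn.
  apply: (bf_c_mul U_ultra Uoo fK); rewrite -/u -len_u; apply/funext => a.
  by rewrite prefix_len_add1 // fctE (bf_len_gen_sign U_ultra Uoo fK).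
have nE : n = bf_len (prefix D).
  apply: lexle_anti => //; apply: prefix_above => // s nDs.
  apply: contrapT => nt; apply: nmin; exists s => // t nDt.
  rewrite leNgt; apply/negP => ts.
  by apply: nt; exists t.
have [b len] := bf_len_mul_gen_sign U_ultra Uoo fK (prefix D) (f' 0%N).
exists (prefix D), (f' 0%N), b; set x := (if _ then _ else _) in len * => u.
have c_vu := bf_c_mul U_ultra Uoo fK len.
split=> //.
  rewrite nE /u len; apply: lexle_pointwise => // a.
  by rewrite fctE lerDl (bf_len_gen_sign U_ultra Uoo fK).
apply: (@lexle_c_trans _ U_ultra Uoo _ _ hA _ _ fK _ _ (prefix D)).
  by rewrite bf_c_prefix // -nE; left.
by rewrite c_vu -nE; left.
Qed.

End Prefixes.

Theorem proposition4p2 (d : Order.disp_t) (A : orderType d)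
    (hA : order_type_omega A) (n : A -> int) (w : BF A)
    (hn : n \in lex_interval 0 (bf_len w)) :
  exists (v : BF A) (a : A),
    tree_point hn \in
      segment (vertex hA v) (vertex hA (bf_mul v (bf_gen a))) \/
    tree_point hn \in
      segment (vertex hA v) (vertex hA (bf_mul v (bf_inv (bf_gen a)))).
Proof.
have [U [U_ultra Uoo]] := ultraFilterLemma eventually_filter.
have [f [[f' fK f'K] f_mono]] := hA.
have [r_red wE] := reduced_formP w.
have [n0 nw] : lex_interval 0 (bf_len w) n by move: hn; rewrite inE.
rewrite -wE in nw.
have [v [a [b [c_vu vn nu n_wu]]]] :=
  prefix_segment U_ultra Uoo hA fK f_mono r_red n0 nw.
rewrite wE in n_wu.
exists v, a; case: b c_vu nu n_wu => c_vu nu n_wu; [right|left];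
  exact: (mem_segment_prefix U_ultra Uoo hA fK c_vu (lexle_trans vn nu) hn
    (conj vn nu) n_wu).
Qed.
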